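(* Let $p\ge 1$, let $g_2,\dots,g_{2p}$ be real with $g_{2p}>0$, let $V(\lambda)=\sum_{j=1}^{p}g_{2j}\lambda^{j}$ and $V_\lambda=dV/d\lambda$, and let $$W(r)=\sum_{k=1}^{p}\binom{2k}{k}k\,g_{2k}\,r^{k}.$$ Let $m\ge 2$ and let $r_{\mathrm c}>0$ satisfy $W'(r_{\mathrm c})=\cdots=W^{(m-1)}(r_{\mathrm c})=0$ and $W^{(m)}(r_{\mathrm c})\neq 0$; put $T_{\mathrm c}=W(r_{\mathrm c})$ and $c_m=\dfrac{W^{(m)}(r_{\mathrm c})}{2^m(2m-1)!!}$. Let $I\subset\mathbb{R}$ be an open interval and let $$r(\bar\epsilon,x)=r_{\mathrm c}+\sum_{k\ge 1}\mathfrak r_k(x)\bar\epsilon^{2k},\qquad U(\lambda,\bar\epsilon;x)=\sum_{k\ge 0}U^{[k]}(\lambda,x)\bar\epsilon^{2k}$$ be formal power series in $\bar\epsilon$, where the $\mathfrak r_k$ are $C^\infty$ on $I$, each $U^{[k]}$ is analytic in $\lambda$ for $|\lambda|>4r_{\mathrm c}$ and $C^\infty$ in $x\in I$, and $U^{[0]}=\sqrt{\lambda/(\lambda-4r_{\mathrm c})}$ (the branch tending to $1$ as $\lambda\to\infty$). Assume that, as formal power series in $\bar\epsilon$, $$r(\bar\epsilon,x)\,\big(U(\lambda,\bar\epsilon;x)+U(\lambda,\bar\epsilon;x-\bar\epsilon)\big)\big(U(\lambda,\bar\epsilon;x)+U(\lambda,\bar\epsilon;x+\bar\epsilon)\big)=\lambda\big(U(\lambda,\bar\epsilon;x)^2-1\big)$$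 and $$\oint_{|\lambda|=R}\frac{d\lambda}{2\pi i}\,V_\lambda(\lambda)\,U(\lambda,\bar\epsilon;x)=T_{\mathrm c}+\bar\epsilon^{2m}x$$ for all $x\in I$ (with $R>4r_{\mathrm c}$, circle positively oriented). Then $u=\mathfrak r_1$ satisfies on $I$ the ordinary differential equation $$c_m\,R_m(u)=x,$$ where $R_0=1$ and, for $j\ge 0$, $R_{j+1}$ is the differential polynomial in $u$ without constant term determined by $\partial_xR_{j+1}=\big(r_{\mathrm c}\partial_x^3+4u\,\partial_x+2u_x\big)R_j$.
   Context: Shifted series are understood via formal Taylor expansion: for $F(\bar\epsilon;x)=\sum_k F_k(x)\bar\epsilon^k$ and a constant $c$, $F(\bar\epsilon;x+c\bar\epsilon)=\sum_{k,n}F_k^{(n)}(x)c^n\bar\epsilon^{k+n}/n!$, and identities between formal series mean equality of the coefficient of each power of $\bar\epsilon$. The contour integral $\oint\frac{d\lambda}{2\pi i}$ over a large positively oriented circle equals the coefficient of $\lambda^{-1}$ in the expansion at $\lambda=\infty$. The equation $c_mR_m(u)=x$ is the $(m-1)$-th member of the Painlevé I hierarchy (for $m=2$: $c_2(2r_{\mathrm c}u_{xx}+6u^2)=x$). *)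

(* Defs.v *)
From HB Require Import structures.
From mathcomp Require Import all_boot all_order all_algebra.
(* mpoly must be imported BEFORE mathcomp-analysis (notation levels) *)
From mathcomp Require Import mpoly.
From mathcomp Require Import all_classical all_reals all_analysis.
From mathcomp Require Import complex.
Import Order.TTheory GRing.Theory Num.Theory.
Import numFieldNormedType.Exports.

Set Implicit Arguments.
Unset Strict Implicit.
Unset Printing Implicit Defensive.

Local Open Scope ring_scope.
Local Open Scope classical_set_scope.

Section Defs.
Variable R : realType.
Local Open Scope complex_scope.

Definition normc (z : R[i]) : R :=
  Num.sqrt (complex.Re z ^+ 2 + complex.Im z ^+ 2).

Definition smooth_on (I : set R) (f : R -> R) : Prop :=
  forall (n : nat) (x : R), I x -> derivable (derive1n n f) x 1.

Definition csmooth_on (I : set R) (f : R -> R[i]) : Prop :=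
  smooth_on I (fun x => complex.Re (f x)) /\ smooth_on I (fun x => complex.Im (f x)).

Definition cderiv (n : nat) (f : R -> R[i]) (x : R) : R[i] :=
  (derive1n n (fun y => complex.Re (f y)) x) +i* (derive1n n (fun y => complex.Im (f y)) x).

Definition cseries_to (u : nat -> R[i]) (s : R[i]) : Prop :=
  forall e : R, 0 < e -> exists N : nat, forall n : nat, (N <= n)%N ->
    normc (\sum_(k < n) u k - s) < e.

Definition analytic_on (D : set R[i]) (f : R[i] -> R[i]) : Prop :=
  forall z0, D z0 -> exists (a : nat -> R[i]) (rho : R), 0 < rho /\
    forall z, normc (z - z0) < rho -> cseries_to (fun n => a n * (z - z0) ^+ n) (f z).

(* contour integral  \oint_{|lambda| = rho} dlambda/(2 pi i) f(lambda),
   circle positively oriented, parametrized lambda = rho e^{i t}, t in [0, 2pi]: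
   = 1/(2 pi) int_0^{2pi} f(rho e^{it}) rho e^{it} dt *)
Definition circle_pt (rho t : R) : R[i] := (rho * cos t) +i* (rho * sin t).
Definition contour_int (f : R[i] -> R[i]) (rho : R) : R[i] :=
  ((2 * pi)^-1)%:C *
  ((Rintegral lebesgue_measure `[0, 2 * pi]
      (fun t => complex.Re (f (circle_pt rho t) * circle_pt rho t)))
   +i*
   (Rintegral lebesgue_measure `[0, 2 * pi]
      (fun t => complex.Im (f (circle_pt rho t) * circle_pt rho t)))).

(* V(lambda) = sum_{j=1}^p g_{2j} lambda^j ;  here g j stands for g_{2j} *)
Definition Vpoly (p : nat) (g : nat -> R) : {poly R} :=
  \sum_(1 <= j < p.+1) g j *: 'X^j.

Definition Vlam (p : nat) (g : nat -> R) (lam : R[i]) : R[i] :=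
  (map_poly (fun c : R => c%:C) (Vpoly p g)^`()).[lam].

Definition Wpoly (p : nat) (g : nat -> R) : {poly R} :=
  \sum_(1 <= k < p.+1) (('C(2 * k, k) * k)%:R * g k) *: 'X^k.

Definition dfact_odd (m : nat) : nat := \prod_(i < m) (2 * i).+1.

Definition c_coef (p : nat) (g : nat -> R) (m : nat) (rc : R) : R :=
  (Wpoly p g)^`(m).[rc] / (2 ^ m * dfact_odd m)%:R.

(* A formal series is the sequence of its coefficients (index = power of eps). *)

Definition sprod (a b : nat -> R[i]) (N : nat) : R[i] :=
  \sum_(i < N.+1) a i * b (N - i)%N.

Definition rser (rc : R) (rk : nat -> R -> R) (x : R) (n : nat) : R[i] :=
  if n == 0%N then rc%:C else if odd n then 0 else (rk n./2 x)%:C.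

Definition User (U : nat -> R[i] -> R -> R[i]) (lam : R[i]) (x : R) (n : nat) : R[i] :=
  if odd n then 0 else U n./2 lam x.

(* U(lambda,eps; x + c eps) by formal Taylor expansion:
   coefficient of eps^N is sum_{2k+n=N} d_x^n U^[k](lambda,x) c^n / n! *)
Definition Ushift (U : nat -> R[i] -> R -> R[i]) (lam : R[i]) (x c : R) (N : nat) : R[i] :=
  \sum_(k < N./2.+1)
     cderiv (N - 2 * k) (fun y => U k lam y) x * (c ^+ (N - 2 * k) / (N - 2 * k)`!%:R)%:C.

End Defs.

(* A differential polynomial in u is a polynomial in u, u_x, u_xx, ...;
   we use the variables X_0, ..., X_(n-1) standing for u, u', ..., u^(n-1).
   The total derivation d/dx acts by  D P = sum_i (dP/dX_i) X_(i+1);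
   the contribution of the top variable X_(n-1) is dropped (only polynomials not involving X_(n-1) are differentiated in a way that
   matters, and the number of variables is chosen large enough). *)

Definition dpoly (R : realType) (n : nat) := mpoly.mpoly n R.

Definition dvar (R : realType) (n : nat) (i : 'I_n) : dpoly R n :=
  mpoly.mpolyX R (mpoly.mnm1 i).

Definition dcst (R : realType) (n : nat) (c : R) : dpoly R n := mpoly.mpolyC n c.

Definition Dx (R : realType) (n : nat) (P : dpoly R n) : dpoly R n :=
  \sum_(i < n | (i.+1 < n)%N) ((mpoly.mderiv i P : mpoly.mpoly n R) * dvar R (insubd i i.+1)).

Definition dconst (R : realType) (n : nat) (P : dpoly R n) : R :=
  mpoly.mcoeff (@mpoly.mnm0 n) P.

Definition no_top (R : realType) (n : nat) (P : dpoly R n) : Prop :=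
  forall i : 'I_n, (i.+1 = n)%N -> mpoly.mderiv i P = 0.

Definition deval (R : realType) (n : nat) (P : dpoly R n) (u : R -> R) (x : R) : R :=
  mpoly.meval (fun i : 'I_n => derive1n i u x) P.

Definition nGD (m : nat) : nat := (2 * m).+2.

Definition GD_family (R : realType) (m : nat) (rc : R) (Rs : nat -> dpoly R (nGD m)) : Prop :=
  let n := nGD m in
  let u := dvar R (inord 0) in
  let ux := dvar R (inord 1) in
  [/\ Rs 0%N = 1,
      forall j, (j <= m)%N -> no_top (Rs j),
      forall j, (j < m)%N -> dconst (Rs j.+1) = 0 &
      forall j, (j < m)%N ->
        Dx (Rs j.+1) = dcst n rc * Dx (Dx (Dx (Rs j)))
                       + dcst n 4 * u * Dx (Rs j) + dcst n 2 * ux * Rs j].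

(* Main.v *)
(** Write [U = U0 P] with [s = 1 / (lam - 4 rc)]. Since [U0^2 = lam s], the
    quadratic equation becomes
      [P^2 - 1 = s (r (P + P_-) (P + P_+) - 4 rc P^2)],
    in which the coefficient [P_k] of [eps^(2k)] cancels on the right; so
    [P_k] is, recursively, a polynomial in [s] of degree at most [k], without
    constant term for [k > 0]. Its leading coefficients [rho_k] satisfy
      [rho^2 - 1 = z (4 u rho^2 + rc (2 rho rho'' - rho'^2))],
      [rho = \sum_k rho_k z^k],
    which is the once integrated recursion for the [R_k], whence
    [rho_k = R_k(u)]. Moreover [2^j (2j-1)!! U0 s^j] is the j-th derivative of
    [\sum_n C(2n, n) rc^n lam^-n] with respect to [rc], so its contour integral
    against [V_lam] is the j-th derivative of [W] at [rc]; for [U_m] only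
    [j = m] survives. The contour integral is evaluated by letting the radius
    tend to infinity, which only requires an asymptotic expansion of [U0]. *)
From Pilot Require Import Defs.
From HB Require Import structures.
From mathcomp Require Import all_boot all_order all_algebra.
From mathcomp Require Import mpoly.
From mathcomp Require Import all_classical all_reals all_analysis.
From mathcomp Require Import complex ring lra zify.
Import Order.TTheory GRing.Theory Num.Theory.
Import numFieldNormedType.Exports.
Local Open Scope ring_scope.
Local Open Scope classical_set_scope.
Local Open Scope complex_scope.
Set Implicit Arguments.
Unset Strict Implicit.
Unset Printing Implicit Defensive.

(* MathComp-Analysis has another [dcst], the differential of a constant. *)
Local Notation dcst := Pilot.Defs.dcst.

(** Weigh [eps^2] against [s]. Further x-derivatives in a Taylor shift raise the power of [eps] but
    not the degree in [s], and [r_a] with [a > 1] costs more [eps^2] than the one factor [s] repays.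
    So the top degree sees only [u = r_1], one second derivative and a product of two first
    derivatives: [4 rho (rho''/2)] gives [2 rho rho''], and the opposite odd parts of the two shifts
    give [-rho'^2].

    The [R_k] are known only through their x-derivatives and zero constant terms, in finitely many
    jet variables, where [Dx] forgets the top one. Integrating the recursion once needs [Dx] to be
    injective up to constants, which holds only for polynomials free of the top variable; hence the
    counting of jet variables.

    The branch [U0] is known only by its square and its limit at infinity, for each x separately.
    Its independence of x follows from smoothness on an interval; its expansion follows by comparing
    squares with a truncated binomial series, the limit excluding the other sign; its continuity on
    large circles follows from its positive real part there. *)

(** * Differential polynomials: the total derivation and its kernel *)

Section DifferentialPolynomials.
Variables (R : realType) (n : nat).
Implicit Types (P Q : dpoly R n) (i j : 'I_n).

Lemma Dx_is_additive : additive (@Dx R n).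
Proof.
move=> P Q; rewrite /Dx -sumrB; apply: eq_bigr => i _.
by rewrite mderivB mulrBl.
Qed.

HB.instance Definition _ :=
  GRing.isAdditive.Build (dpoly R n) (dpoly R n) (@Dx R n) Dx_is_additive.

Lemma DxD P Q : Dx (P + Q) = Dx P + Dx Q.
Proof. exact: raddfD. Qed.

Lemma DxB P Q : Dx (P - Q) = Dx P - Dx Q.
Proof. exact: raddfB. Qed.

Lemma DxM P Q : Dx (P * Q) = Dx P * Q + P * Dx Q.
Proof.
rewrite /Dx mulr_suml mulr_sumr -big_split /=; apply: eq_bigr => i _.
rewrite mderivM; ring.
Qed.

Lemma Dx_cst (c : R) : Dx (dcst n c) = 0.
Proof. by rewrite /Dx big1 // => i _; rewrite mderivC mul0r. Qed.

Lemma Dx_cstM (c : R) P : Dx (dcst n c * P) = dcst n c * Dx P.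
Proof. by rewrite DxM Dx_cst mul0r add0r. Qed.

Lemma Dx1 : Dx (1 : dpoly R n) = 0.
Proof. by rewrite -[1]/(dcst n 1) Dx_cst. Qed.

Lemma mderiv_dvar i j : mderiv j (dvar R i) = (i == j)%:R.
Proof.
rewrite /dvar mderivX mnm1E; case: eqP => [->|_]; last by rewrite scale0r.
rewrite scale1r (_ : (_ - _)%MM = 0%MM) ?mpolyX0 //.
by apply/mnmP => k; rewrite mnmBE subnn mnmE.
Qed.

Lemma Dx_dvar i j : j = i.+1 :> nat -> Dx (dvar R i) = dvar R j.
Proof.
move=> ji; have jn : (i.+1 < n)%N by rewrite -ji.
rewrite /Dx (bigD1 i) //= big1 ?addr0.
  rewrite mderiv_dvar eqxx mul1r; congr dvar; apply: val_inj.
  by rewrite /= insubdK.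
by move=> k /andP[_ ki]; rewrite mderiv_dvar eq_sym (negbTE ki) mul0r.
Qed.

(** The commutator of [d/dX_(i+1)] with [Dx] is [d/dX_i], because [X_(i+1)] enters [Dx] as the
    factor of [d/dX_i]. It transfers bounds on the variables of [P] to [Dx P] and back. *)
Lemma mderiv_DxS P i j :
  j = i.+1 :> nat -> mderiv j (Dx P) = Dx (mderiv j P) + mderiv i P.
Proof.
move=> ji; have jn : (i.+1 < n)%N by rewrite -ji.
rewrite /Dx raddf_sum /=.
under eq_bigr => k _ do rewrite mderivM mderiv_dvar mderiv_comm.
rewrite big_split /=; congr (_ + _).
rewrite (bigD1 i) //= big1 ?addr0.
  have -> : insubd i i.+1 = j by apply: val_inj; rewrite /= insubdK.
  by rewrite eqxx mulr1.
move=> k /andP[kn ki]; case: eqP => [kj|]; last by rewrite mulr0.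
case/eqP: ki; apply: val_inj; have /(congr1 val) := kj.
by rewrite /= insubdK // ji => -[].
Qed.

(** Order of a differential polynomial, stated through partial derivatives to fit the commutator;
    [no_top] is the case [d = n - 1]. *)
Definition vars_lt (d : nat) P := forall i, (d <= i)%N -> mderiv i P = 0.

Lemma vars_lt_le d e P : (d <= e)%N -> vars_lt d P -> vars_lt e P.
Proof. by move=> de Pd i ei; apply: Pd; apply: leq_trans ei. Qed.

Lemma vars_lt_cst c d : vars_lt d (dcst n c).
Proof. by move=> i _; rewrite /dcst mderivC. Qed.

Lemma vars_ltD d P Q : vars_lt d P -> vars_lt d Q -> vars_lt d (P + Q).
Proof. by move=> Pd Qd i di; rewrite mderivD Pd // Qd // addr0. Qed.

Lemma vars_ltB d P Q : vars_lt d P -> vars_lt d Q -> vars_lt d (P - Q).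
Proof. by move=> Pd Qd i di; rewrite mderivB Pd // Qd // subr0. Qed.

Lemma vars_ltM d P Q : vars_lt d P -> vars_lt d Q -> vars_lt d (P * Q).
Proof. by move=> Pd Qd i di; rewrite mderivM Pd // Qd // mulr0 mul0r addr0. Qed.

Lemma vars_lt_sum d k (F : 'I_k -> dpoly R n) :
  (forall l, vars_lt d (F l)) -> vars_lt d (\sum_(l < k) F l).
Proof.
by move=> Fd i di; rewrite raddf_sum big1 // => l _; apply: Fd.
Qed.

Lemma vars_lt_dvar d i : (i < d)%N -> vars_lt d (dvar R i).
Proof.
move=> id j dj; rewrite mderiv_dvar; case: eqP => // ij.
by move: dj; rewrite -ij leqNgt id.
Qed.

Lemma vars_lt_Dx d P : vars_lt d P -> vars_lt d.+1 (Dx P).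
Proof.
move=> Pd i di; have i1 : (i.-1 < n)%N by rewrite (leq_ltn_trans (leq_pred _)).
rewrite (@mderiv_DxS _ (Ordinal i1)) /=; last by rewrite prednK //; lia.
by rewrite !Pd ?raddf0 ?addr0 //=; lia.
Qed.

(** Downward induction on the index, started by [no_top]: once [X_(i+1)] is absent from [P], the
    commutator identifies [dP/dX_i] with [d(Dx P)/dX_(i+1)], which vanishes. *)
Lemma vars_lt_Dx_inv d P : no_top P -> vars_lt d.+1 (Dx P) -> vars_lt d P.
Proof.
move=> Ptop DP i; move: {2}(n - i)%N (leqnn (n - i)) => k.
elim: k i => [|k IHk] i ik di; first by have := ltn_ord i; lia.
have [in1|in1] := eqVneq i.+1 n; first exact: Ptop.
have i1n : (i.+1 < n)%N by have := ltn_ord i; lia.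
have := @mderiv_DxS P i (Ordinal i1n) erefl.
by rewrite DP //= IHk /= ?raddf0 ?add0r //; lia.
Qed.

Lemma vars_lt0_cst P : vars_lt 0 P -> P = dcst n (dconst P).
Proof.
move=> P0; apply/mpolyP => mm; rewrite mcoeffC.
have [->|mm0] := eqVneq mm 0%MM; first by rewrite mulr1.
rewrite mulr0.
have [i mi] : exists i, mm i != 0%N.
  apply/existsP; apply: contraNT mm0 => /existsPn mm0.
  by apply/eqP/mnmP => i; rewrite mnm0E; apply/eqP; rewrite -[_ == _]negbK mm0.
(* The coefficient of [P] at [mm] reappears in [dP/dX_i] multiplied by [mm i], which is nonzero in
   characteristic 0. *)
have /(congr1 (mcoeff (mm - U_(i))%MM)) := P0 i (leq0n _).
rewrite mcoeff_deriv mcoeff0 submK; last first.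
  by apply/mnm_lepP => j; rewrite mnm1E; case: eqP => [<-|//]; rewrite lt0n.
by move=> /eqP; rewrite mulrn_eq0 /= => /eqP.
Qed.

(** Uniqueness of integration in x up to a constant. Freedom from the top variable is essential,
    since [Dx] kills [X_(n-1)]. *)
Lemma Dx_eq0 P : no_top P -> Dx P = 0 -> P = dcst n (dconst P).
Proof.
move=> Ptop DP0; apply: vars_lt0_cst; apply: vars_lt_Dx_inv => //.
by rewrite DP0 => i _; rewrite mderiv0.
Qed.

Lemma dconstM P Q : dconst (P * Q) = dconst P * dconst Q.
Proof. exact: (mcoeff0_is_multiplicative n R).1. Qed.

Lemma dconst_dvar i : dconst (dvar R i) = 0.
Proof.
rewrite /dconst mcoeffX; case: eqP => // /(congr1 (fun mm : 'X_{1..n} => mm i)).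
by rewrite mnm1E mnm0E eqxx.
Qed.

Lemma dconst_sum k (F : 'I_k -> dpoly R n) :
  dconst (\sum_(l < k) F l) = \sum_(l < k) dconst (F l).
Proof. exact: raddf_sum. Qed.

Lemma dconst_Dx P : dconst (Dx P) = 0.
Proof.
rewrite /Dx /dconst raddf_sum big1 //= => i _.
by rewrite -/(dconst _) dconstM dconst_dvar mulr0.
Qed.

End DifferentialPolynomials.

(** * The recursion for the [R_k] and its first integral *)

Lemma sum_rev_sub (V : zmodType) (k : nat) (F : nat -> nat -> V) :
  \sum_(i < k) (F i (k - i.+1)%N - F (k - i.+1)%N i) = 0.
Proof.
rewrite sumrB [X in _ - X](reindex_inj rev_ord_inj) /=.
apply/eqP; rewrite subr_eq0; apply/eqP/eq_bigr => i _.
by have ik := ltn_ord i; congr F; lia.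
Qed.

(** Here [a], [b] stand for two members [R_i], [R_j] with their derivatives, and the factor [0] is
    the derivative of the constant 2. Term by term, the recursion and the derivative of the first
    integral differ, but only by an expression antisymmetric in [a] and [b]. *)
Lemma GD_identity (A : comNzRingType) (c u ux a a1 a2 a3 b b1 b2 b3 : A) :
  a * (c * b3 + 4 * (u * b1) + 2 * (ux * b))
  + (c * a3 + 4 * (u * a1) + 2 * (ux * a)) * b
  - (4 * (ux * (a * b) + u * (a1 * b + a * b1))
     + c * (0 * (a * b2) + 2 * (a1 * b2 + a * b3) - (a2 * b1 + a1 * b2)))
  = c * (a3 * b + a2 * b1) - c * (b3 * a + b2 * a1).
Proof. ring. Qed.

Section GelfandDickey.
Variables (R : realType) (m : nat) (rc : R) (Rs : nat -> dpoly R (nGD m)).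
Hypothesis RsP : GD_family rc Rs.
Let n := nGD m.
Let u := dvar R (inord 0 : 'I_n).
Let ux := dvar R (inord 1 : 'I_n).

Let Dx_u : Dx u = ux.
Proof. by apply: Dx_dvar; rewrite !inordK. Qed.

(** Three derivations add three variables and the integration removes one, so each step costs two.
    The bound leaves room for the two derivations in the quadratic identity. *)
Lemma GD_vars_lt j : (j <= m)%N -> vars_lt (2 * j) (Rs j).
Proof.
have [Rs0 Rstop _ RsS] := RsP.
elim: j => [_|j IHj jm]; first by rewrite Rs0; exact: (@vars_lt_cst R n 1).
have Rj := IHj (ltnW jm).
apply: vars_lt_Dx_inv; first exact: Rstop.
rewrite RsS // mulnS; apply: vars_ltD; [apply: vars_ltD|].
- apply: vars_ltM; first exact: vars_lt_cst.
  by do 3!apply: vars_lt_Dx.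
- apply: vars_ltM.
    apply: vars_ltM; first exact: vars_lt_cst.
    by apply: vars_lt_dvar; rewrite inordK.
  by apply: vars_lt_le (vars_lt_Dx Rj); lia.
- apply: vars_ltM; last by apply: vars_lt_le Rj; lia.
  apply: vars_ltM; first exact: vars_lt_cst.
  by apply: vars_lt_dvar; rewrite inordK.
Qed.

(* First integral of the recursion: [\sum_k R_k z^k] solves
   [rho^2 - 1 = z (4 u rho^2 + rc (2 rho rho'' - rho'^2))], whose x-derivative
   is [2 rho] times the recursion for the [R_k]. *)
Lemma GD_quadratic k : (0 < k <= m)%N ->
  \sum_(i < k.+1) Rs i * Rs (k - i)%N =
  \sum_(i < k) (dcst n 4 * u * (Rs i * Rs (k - i.+1)%N)
    + dcst n rc * (dcst n 2 * Rs i * Dx (Dx (Rs (k - i.+1)%N))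
                   - Dx (Rs i) * Dx (Rs (k - i.+1)%N))).
Proof.
have [Rs0 _ Rsc RsS] := RsP.
move=> /andP[k0 km]; apply/eqP; rewrite -subr_eq0; apply/eqP.
set Q := _ - _.
(* The top variable has index [2 m + 1], so this bound is exactly [no_top]. *)
have Qtop : vars_lt (2 * m).+1 Q.
  have Rjm j : (j <= m)%N -> vars_lt (2 * m).+1 (Rs j).
    by move=> jm; apply: vars_lt_le (GD_vars_lt jm); lia.
  have DRjm j : (j < m)%N -> vars_lt (2 * m).+1 (Dx (Rs j)).
    by move=> jm; apply: vars_lt_le (vars_lt_Dx (GD_vars_lt (ltnW jm))); lia.
  have DDRjm j : (j < m)%N -> vars_lt (2 * m).+1 (Dx (Dx (Rs j))).
    move=> jm; apply: vars_lt_le (vars_lt_Dx (vars_lt_Dx (GD_vars_lt (ltnW jm)))).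
    lia.
  apply: vars_ltB; apply: vars_lt_sum => i; have := ltn_ord i => ik.
    by apply: vars_ltM; apply: Rjm; lia.
  apply: vars_ltD.
    apply: vars_ltM; last by apply: vars_ltM; apply: Rjm; lia.
    by apply: vars_ltM; [exact: vars_lt_cst|apply: vars_lt_dvar; rewrite inordK].
  apply: vars_ltM; first exact: vars_lt_cst.
  apply: vars_ltB; last by apply: vars_ltM; apply: DRjm; lia.
  apply: vars_ltM; last by apply: DDRjm; lia.
  by apply: vars_ltM; [exact: vars_lt_cst|apply: Rjm; lia].
have Qcst : dconst Q = 0.
  rewrite /Q /dconst mcoeffB -!/(dconst _) !dconst_sum big_ord_recl /=.
  rewrite !big1 => [|i _|i _]; rewrite ?subn0.
  - rewrite dconstM -(prednK k0) Rsc; last by rewrite prednK.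
    by rewrite mulr0 addr0 subr0.
  - rewrite /dconst mcoeffD -!/(dconst _) !dconstM dconst_dvar mulr0 mul0r.
    by rewrite /dconst mcoeffB -!/(dconst _) !dconstM !dconst_Dx !mulr0 subr0 mulr0 addr0.
  - by rewrite dconstM /= /bump /= add1n Rsc ?mul0r //; have := ltn_ord i; lia.
suff DQ : Dx Q = 0.
  rewrite (Dx_eq0 _ DQ) ?Qcst /dcst ?mpolyC0 // => i iS.
  by apply: Qtop; move: iS; rewrite /nGD; lia.
pose N j := dcst n rc * Dx (Dx (Dx (Rs j))) + dcst n 4 * u * Dx (Rs j)
            + dcst n 2 * ux * Rs j.
have RsN (i : 'I_k) : Dx (Rs (k - i)%N) = N (k - i.+1)%N.
  by have ik := ltn_ord i; rewrite /N -RsS; [congr (Dx (Rs _))|]; lia.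
(* Each half of the product rule loses its term with [Dx (Rs 0) = 0], which shortens the range from
   [k + 1] to [k]. *)
have DsumRR : Dx (\sum_(i < k.+1) Rs i * Rs (k - i)%N) =
    \sum_(i < k) (Rs i * N (k - i.+1)%N + N i * Rs (k - i.+1)%N).
  rewrite raddf_sum /= big_split /=.
  under eq_bigr => i _ do rewrite DxM addrC.
  rewrite big_split /= big_ord_recr /= subnn Rs0 Dx1 mulr0 addr0; congr (_ + _).
    by apply: eq_bigr => i _; rewrite RsN.
  rewrite big_ord_recl /= Rs0 Dx1 mul0r add0r; apply: eq_bigr => i _.
  rewrite (_ : bump 0 i = i.+1) //.
  by congr (_ * _); rewrite /N -RsS // (leq_trans (ltn_ord i)).
rewrite /Q raddfB /= DsumRR [X in _ - X]raddf_sum -sumrB /=.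
(* The antisymmetric remainder of [GD_identity] is [F i j - F j i] with [i + j = k - 1], and it
   cancels on reversing the sum. *)
pose F i j := dcst n rc * (Dx (Dx (Dx (Rs i))) * Rs j + Dx (Dx (Rs i)) * Dx (Rs j)).
rewrite -[RHS](sum_rev_sub k F); apply: eq_bigr => i _.
have d2 : dcst n (2 : R) = 2%:R by exact: (mpolyC_nat n R 2).
have d4 : dcst n (4 : R) = 4%:R by exact: (mpolyC_nat n R 4).
rewrite /N /F DxD -!mulrA !Dx_cstM DxB !DxM !Dx_cst Dx_u d2 d4.
exact: GD_identity.
Qed.

End GelfandDickey.

(** * Evaluation of differential polynomials along a function *)

Section Evaluation.
Variables (R : realType) (n : nat) (u : R -> R) (x : R).
Hypothesis u_derivable : forall k, derivable (derive1n k u) x 1.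

(** Chain rule over all [n] variables. The top one contributes through the [n]-th derivative of [u],
    a term which [Dx] drops; hence [no_top] when the result is compared with [Dx]. *)
Lemma is_derive_deval (P : dpoly R n) :
  is_derive x 1 (deval P u)
    (\sum_(i < n) deval (mderiv i P) u x * derive1n i.+1 u x).
Proof.
pose c (P : dpoly R n) := is_derive x 1 (deval P u)
    (\sum_(i < n) deval (mderiv i P) u x * derive1n i.+1 u x).
have cM (A B : dpoly R n) : c A -> c B -> c (A * B).
  move=> cA cB; rewrite /c.
  have -> : deval (A * B) u = deval A u * deval B u.
    by apply/funext => y; rewrite /deval mevalM.
  apply: (is_derive_eq (is_deriveM cA cB)).
  rewrite /GRing.scale /= !mulr_sumr -big_split /=.
  apply: eq_bigr => i _; rewrite /deval mderivM mevalD !mevalM; ring.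
have cC a : c (dcst n a).
  rewrite /c (_ : deval _ _ = cst a); last first.
    by apply/funext => y; rewrite /deval mevalC.
  apply: is_derive_eq; rewrite big1 // => i _.
  by rewrite /deval mderivC meval0 mul0r.
have cX i : c (dvar R i).
  rewrite /c (_ : deval _ _ = derive1n i u); last first.
    by apply/funext => y; rewrite /deval mevalXU.
  apply: (is_derive_eq (derivableP (@u_derivable i))).
  rewrite (bigD1 i) //= big1 ?addr0; last first.
    move=> j ji; rewrite /deval mderiv_dvar eq_sym (negbTE ji).
    by rewrite meval0 mul0r.
  by rewrite /deval mderiv_dvar eqxx meval1 mul1r derive1E.
elim/mpolyind: P => [|a mm p _ _ cp]; first by rewrite -[0]/(dcst n 0); apply: cC.
rewrite -/(c _) -mul_mpolyC.
have {}cp : c p by [].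
have cm : c (a%:MP * 'X_[mm]).
  apply: (cM _ _); first exact: cC.
  rewrite mpolyXE_id; apply: (big_ind c); [exact: (cC 1)|exact: cM|].
  move=> i _; elim: (mm i) => [|k IHk]; first by rewrite expr0; exact: (cC 1).
  by rewrite exprS; apply: cM => //; apply: cX.
rewrite /c (_ : deval _ _ = deval (a%:MP * 'X_[mm]) u + deval p u); last first.
  by apply/funext => y; rewrite /deval mevalD.
apply: (is_derive_eq (is_deriveD cm cp)); rewrite -big_split /=.
by apply: eq_bigr => i _; rewrite /deval mderivD mevalD mulrDl.
Qed.

Lemma derive1_deval (P : dpoly R n) : no_top P ->
  derivable (deval P u) x 1 /\ (deval P u)^`() x = deval (Dx P) u x.
Proof.
move=> Ptop; have [dP PE] := is_derive_deval P; split => //.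
rewrite derive1E PE /Dx (big_morph (fun P => deval P u x)
  (fun A B => mevalD _ A B) (meval0 _)) [RHS]big_mkcond /=.
apply: eq_bigr => i _.
case: ifPn => [i1|i1].
  by rewrite /deval mevalM mevalXU /= insubdK.
by rewrite /deval Ptop ?meval0 ?mul0r //; have := ltn_ord i; lia.
Qed.

End Evaluation.

(** * Smooth functions on an open set *)

Section SmoothFunctions.
Variables (R : realType) (I : set R).
Hypothesis oI : open I.
Implicit Types (f g : R -> R).

Lemma near_open (x : R) (P : R -> Prop) :
  I x -> (forall y, I y -> P y) -> \forall y \near x, P y.
Proof.
move=> Ix IP; have : nbhs x I by apply: open_nbhs_nbhs.
by apply: filterS.
Qed.

Lemma derivable_open_eq f g x : (forall y, I y -> f y = g y) -> I x ->
  derivable f x 1 -> derivable g x 1.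
Proof. by move=> fg Ix; apply: near_eq_derivable; apply: near_open. Qed.

Lemma derive1n_open_eq f g n x : (forall y, I y -> f y = g y) -> I x ->
  derive1n n f x = derive1n n g x.
Proof.
move=> fg; elim: n x => [|n IHn] x Ix; first exact: fg.
by rewrite !derive1nS !derive1E; apply: near_eq_derive; apply: near_open.
Qed.

Lemma derive1nD n k f : derive1n n (derive1n k f) = derive1n (n + k) f.
Proof. by elim: n => // n IHn; rewrite addSn !derive1nS IHn. Qed.

Lemma smooth_on_derive1n k f : smooth_on I f -> smooth_on I (derive1n k f).
Proof. by move=> sf n x Ix; rewrite derive1nD; apply: sf. Qed.

Lemma smooth_on_open_eq f g : (forall y, I y -> f y = g y) ->
  smooth_on I f -> smooth_on I g.
Proof.
move=> fg sf n x Ix; apply: (derivable_open_eq _ Ix (sf n x Ix)) => y Iy.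
exact: derive1n_open_eq.
Qed.

(** Recursion on the first derivative instead of the [n]-th iterate: sums and products then follow
    by induction with [f] and [g] generalised, without the general Leibniz formula. *)
Fixpoint derivable_order n f : Prop :=
  (forall x, I x -> derivable f x 1) /\
  (if n is n'.+1 then derivable_order n' f^`() else True).

Lemma smooth_onP f : smooth_on I f <-> forall n, derivable_order n f.
Proof.
split=> [sf n|fn n].
  elim: n f sf => [|n IHn] f sf; first by split=> //; apply: (sf 0%N).
  split; first exact: (sf 0%N).
  by apply: IHn => k; rewrite -derive1n1 derive1nD addn1; apply: sf.
elim: n f fn => [|n IHn] f fn x Ix; first exact: (fn 0%N).1.
rewrite -addn1 -derive1nD derive1n1; apply: IHn => // k.
exact: (fn k.+1).2.
Qed.

Lemma derivable_order_eq n f g : (forall y, I y -> f y = g y) ->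
  derivable_order n f -> derivable_order n g.
Proof.
elim: n f g => [|n IHn] f g fg [df Df].
  by split; [move=> x Ix; apply: derivable_open_eq (df x Ix)|].
split; first by move=> x Ix; apply: derivable_open_eq (df x Ix).
apply: IHn Df => y Iy; have := @derive1n_open_eq _ _ 1 _ fg Iy.
by rewrite !derive1n1.
Qed.

Lemma derivable_orderS n f : derivable_order n.+1 f -> derivable_order n f.
Proof. by elim: n f => [|n IHn] f [df Df]; split => //; apply: IHn. Qed.

Lemma derivable_order_add n f g :
  derivable_order n f -> derivable_order n g -> derivable_order n (f + g).
Proof.
elim: n f g => [|n IHn] f g [df Df] [dg Dg].
  by split; [move=> x Ix; exact: derivableD (df x Ix) (dg x Ix)|].
split; first by move=> x Ix; exact: derivableD (df x Ix) (dg x Ix).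
apply: derivable_order_eq (IHn _ _ Df Dg) => y Iy.
by rewrite !derive1E deriveD; [rewrite -!derive1E|apply: df|apply: dg].
Qed.

Lemma derivable_order_mul n f g :
  derivable_order n f -> derivable_order n g -> derivable_order n (f * g).
Proof.
elim: n f g => [|n IHn] f g.
  move=> [df _] [dg _].
  by split; [move=> x Ix; exact: derivableM (df x Ix) (dg x Ix)|].
move=> fn gn; have [df Df] := fn; have [dg Dg] := gn; split.
  by move=> x Ix; exact: derivableM (df x Ix) (dg x Ix).
have := derivable_order_add (IHn _ _ (derivable_orderS fn) Dg)
  (IHn _ _ (derivable_orderS gn) Df).
apply: derivable_order_eq => y Iy.
by rewrite !derive1E deriveM; [rewrite -!derive1E|apply: df|apply: dg].
Qed.

Lemma smooth_on_cst a : smooth_on I (cst a).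
Proof.
apply/smooth_onP => n; elim: n a => [|n IHn] a.
  by split=> // x Ix; apply: derivable_cst.
split=> [x Ix|]; first exact: derivable_cst.
by apply: derivable_order_eq (IHn 0) => y _; rewrite derive1_cst.
Qed.

Lemma smooth_onD f g : smooth_on I f -> smooth_on I g ->
  smooth_on I (fun x => f x + g x).
Proof.
by move=> /smooth_onP sf /smooth_onP sg; apply/smooth_onP => n; apply: derivable_order_add.
Qed.

Lemma smooth_onM f g : smooth_on I f -> smooth_on I g ->
  smooth_on I (fun x => f x * g x).
Proof.
by move=> /smooth_onP sf /smooth_onP sg; apply/smooth_onP => n; apply: derivable_order_mul.
Qed.

Lemma smooth_on_sum (T : Type) (r : seq T) (P : pred T) (F : T -> R -> R) :
  (forall i, P i -> smooth_on I (F i)) ->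
  smooth_on I (fun x => \sum_(i <- r | P i) F i x).
Proof.
move=> sF; elim: r => [|a r IHr].
  apply: (@smooth_on_open_eq (cst 0)); last exact: smooth_on_cst.
  by move=> y _; rewrite big_nil.
have [Pa|Pa] := boolP (P a).
  apply: smooth_on_open_eq (smooth_onD (sF a Pa) IHr) => y _.
  by rewrite big_cons Pa.
by apply: smooth_on_open_eq IHr => y _; rewrite big_cons (negbTE Pa).
Qed.

Lemma derive1n_sum (d n : nat) (b : nat -> R -> R) (c : nat -> R) x :
  (forall j, smooth_on I (b j)) -> I x ->
  derive1n n (fun y => \sum_(j < d) b j y * c j) x
  = \sum_(j < d) derive1n n (b j) x * c j.
Proof.
move=> sb; elim: n x => // n IHn x Ix; rewrite derive1nS derive1E.
rewrite (@near_eq_derive _ _ _ _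
  (\sum_(j < d) (fun y => derive1n n (b j) y * c j)) x); last first.
  by apply: near_open => // y Iy; rewrite IHn // fct_sumE.
rewrite derive_sum => [|j]; last first.
  by apply: derivableM; [apply: sb|apply: derivable_cst].
apply: eq_bigr => j _; rewrite derive1nS -derive1E derive1Mr //; exact: sb.
Qed.

Lemma cderiv_sum (d n : nat) (b : nat -> R -> R) (w : nat -> R[i])
    (f : R -> R[i]) x :
  (forall j, smooth_on I (b j)) ->
  (forall y, I y -> f y = \sum_(j < d) (b j y)%:C * w j) -> I x ->
  cderiv n f x = \sum_(j < d) (derive1n n (b j) x)%:C * w j.
Proof.
move=> sb fE Ix.
have ReS (a : nat -> R) : complex.Re (\sum_(j < d) (a j)%:C * w j)
    = \sum_(j < d) a j * complex.Re (w j).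
  by rewrite (raddf_sum (@complex.Re R)); apply: eq_bigr => j _; case: (w j) => ? ? /=; ring.
have ImS (a : nat -> R) : complex.Im (\sum_(j < d) (a j)%:C * w j)
    = \sum_(j < d) a j * complex.Im (w j).
  by rewrite (raddf_sum (@complex.Im R)); apply: eq_bigr => j _; case: (w j) => ? ? /=; ring.
apply/eqP; rewrite eq_complex /= (ReS (fun j => derive1n n (b j) x)).
rewrite (ImS (fun j => derive1n n (b j) x)).
rewrite -(@derive1n_sum d n b (fun j => complex.Re (w j))) //.
rewrite -(@derive1n_sum d n b (fun j => complex.Im (w j))) //; apply/andP; split; apply/eqP.
  by apply: derive1n_open_eq => // y Iy; rewrite fE // (ReS (fun j => b j y)).
by apply: derive1n_open_eq => // y Iy; rewrite fE // (ImS (fun j => b j y)).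
Qed.

Lemma derivable0_cst f : is_interval I ->
  (forall x, I x -> is_derive x 1 f 0) -> {in I &, forall x y, f x = f y}.
Proof.
move=> iI df; suff H x y : I x -> I y -> x <= y -> f x = f y.
  move=> x y; rewrite !inE => Ix Iy; have [xy|/ltW yx] := leP x y; first exact: H.
  by rewrite (H y x).
move=> Ix Iy xy.
have xyI z : z \in `[x, y]%R -> I z by rewrite in_itv; apply: iI.
have [||c _ /eqP] := @MVT_segment R f (cst 0) x y xy.
- move=> z zxy; apply: df; apply: xyI; exact: subset_itv_oo_cc zxy.
- apply: derivable_within_continuous => z /xyI /df dz.
  exact: ex_derive.
- by rewrite mul0r subr_eq0 => /eqP.
Qed.

(** With [f = a + i b], differentiating the real and imaginary parts of [f^2 = c] gives
    [a a' = b b'] and [a b' + b a' = 0], so [a'] and [b'] are killed by [a^2 + b^2], which is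
    nonzero. *)
Lemma csqrt_cst (f : R -> R[i]) (c : R[i]) : is_interval I -> csmooth_on I f ->
  c != 0 -> (forall x, I x -> f x ^+ 2 = c) -> {in I &, forall x y, f x = f y}.
Proof.
move=> iI [sRe sIm] c0 fc.
pose a x := complex.Re (f x); pose b x := complex.Im (f x).
have fE x : f x = (a x +i* b x)%C by rewrite /a /b; case: (f x).
have dab x : I x -> 'D_1 a x = 0 /\ 'D_1 b x = 0.
  move=> Ix; have da : derivable a x 1 := sRe 0%N x Ix.
  have db : derivable b x 1 := sIm 0%N x Ix.
  have H1 : a x * 'D_1 a x = b x * 'D_1 b x.
    have [_] := is_deriveB (is_deriveM (derivableP da) (derivableP da))
      (is_deriveM (derivableP db) (derivableP db)).
    have -> : 'D_1 (a * a - b * b) x = 0.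
      rewrite (@near_eq_derive _ _ _ _ (cst (complex.Re c)) x) ?derive_cst //.
      by apply: near_open => // y Iy; rewrite -(fc _ Iy) fE.
    rewrite /GRing.scale /= => H; lra.
  have H2 : a x * 'D_1 b x + b x * 'D_1 a x = 0.
    have [_] := is_deriveM (derivableP da) (derivableP db).
    have -> : 'D_1 (a * b) x = 0.
      rewrite (@near_eq_derive _ _ _ _ (cst (complex.Im c / 2)) x) ?derive_cst //.
      apply: near_open => // y Iy; rewrite -(fc _ Iy) fE /= mulrfctE; lra.
    by rewrite /GRing.scale /= => ->.
  have ab0 : a x ^+ 2 + b x ^+ 2 != 0.
    apply: contra c0; rewrite paddr_eq0 ?sqr_ge0 // !sqrf_eq0 => /andP[/eqP a0 /eqP b0].
    by rewrite -(fc _ Ix) fE a0 b0 expr2 eq_complex /= !mulr0 subrr addr0 eqxx.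
  split; apply/eqP; rewrite -(mulrI_eq0 _ (mulfI ab0)); apply/eqP.
    transitivity (a x * (a x * 'D_1 a x) + b x * (b x * 'D_1 a x)); first by ring.
    rewrite H1 (_ : b x * 'D_1 a x = - (a x * 'D_1 b x)); first by ring.
    by apply/eqP; rewrite -subr_eq0 opprK addrC H2.
  transitivity (a x * (a x * 'D_1 b x) + b x * (b x * 'D_1 b x)); first by ring.
  rewrite -H1 (_ : a x * 'D_1 b x = - (b x * 'D_1 a x)); first by ring.
  by apply/eqP; rewrite -subr_eq0 opprK H2.
move=> x y xI yI; rewrite !fE.
by congr (_ +i* _)%C; apply: derivable0_cst => // z Iz; split;
  [exact: sRe 0%N z Iz|case: (dab z Iz)|exact: sIm 0%N z Iz|case: (dab z Iz)].
Qed.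

End SmoothFunctions.

(** * Quadratic convolutions coming from the string equation *)

Section QuadraticForms.
Variable A : comNzRingType.
Implicit Types p e o : nat -> A.

Definition Cauchy_mid p k : A := \sum_(i < k.-1) p i.+1 * p (k - i.+1)%N.

(** Coefficient of [eps^(2n)] in [(P + P_-) (P + P_+)], the factors having even coefficients
    [2 p_i + e_i] and odd coefficients [-o_i] and [o_i]; two odd orders [2i + 1] and
    [2(n - i - 1) + 1] add up to [2n]. *)
Definition shift_prod p e o n : A :=
  \sum_(i < n.+1) (2 * p i + e i) * (2 * p (n - i)%N + e (n - i)%N)
  - \sum_(i < n) o i * o (n - i.+1)%N.

(** Excess of [shift_prod] over four times the self-convolution of [p]. It contains no [p k]. *)
Definition shift_defect p e o k : A :=
  \sum_(i < k) (4 * (p i * e (k - i)%N) + e i * e (k - i)%N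
                - o i * o (k - i.+1)%N).

Lemma Cauchy_midE p k : (0 < k)%N ->
  \sum_(i < k.+1) p i * p (k - i)%N = 2 * (p 0%N * p k) + Cauchy_mid p k.
Proof.
case: k => // k _; rewrite big_ord_recl big_ord_recr /= subn0 subnn /Cauchy_mid /=.
rewrite /bump /= add1n; ring.
Qed.

Lemma shift_prodE p e o k : e 0%N = 0 ->
  shift_prod p e o k =
  4 * (\sum_(i < k.+1) p i * p (k - i)%N) + shift_defect p e o k.
Proof.
move=> e0; rewrite /shift_prod /shift_defect sumrB addrA; congr (_ - _).
have -> : \sum_(i < k) (4 * (p i * e (k - i)%N) + e i * e (k - i)%N)
   = \sum_(i < k.+1) (4 * (p i * e (k - i)%N) + e i * e (k - i)%N).
  by rewrite big_ord_recr /= subnn e0 !mulr0 !addr0.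
have rv : \sum_(i < k.+1) e i * p (k - i)%N = \sum_(i < k.+1) p i * e (k - i)%N.
  rewrite (reindex_inj rev_ord_inj) /=; apply: eq_bigr => i _.
  by rewrite mulrC subSS; congr (p _ * e _); have := ltn_ord i; lia.
transitivity (4 * (\sum_(i < k.+1) p i * p (k - i)%N)
  + 2 * (\sum_(i < k.+1) e i * p (k - i)%N) + 2 * (\sum_(i < k.+1) p i * e (k - i)%N)
  + \sum_(i < k.+1) e i * e (k - i)%N).
  by rewrite !mulr_sumr -!big_split /=; apply: eq_bigr => i _; ring.
rewrite rv big_split /= -mulr_sumr; ring.
Qed.

End QuadraticForms.

Section ScaledMorphism.
Variables (A B : comNzRingType) (f : {rmorphism A -> B}) (v : B).
Variables (p e o : nat -> A) (p' e' o' : nat -> B) (k : nat).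
Hypotheses (pE : forall i, (i < k)%N -> p' i = v * f (p i))
  (eE : forall i, (i <= k)%N -> e' i = v * f (e i))
  (oE : forall i, (i < k)%N -> o' i = v * f (o i)).

(** The forms are homogeneous of degree two, so a common factor [v] comes out squared; the intended
    [v] is [U0] and [f] is evaluation at [s]. Only [e] is needed at index [k], where it is built
    from earlier terms. *)
Lemma Cauchy_mid_scale : Cauchy_mid p' k = v ^+ 2 * f (Cauchy_mid p k).
Proof.
rewrite /Cauchy_mid rmorph_sum mulr_sumr; apply: eq_bigr => i _.
by rewrite rmorphM /= !pE; [ring| |]; have := ltn_ord i; lia.
Qed.

Lemma shift_prod_scale n : (n < k)%N ->
  shift_prod p' e' o' n = v ^+ 2 * f (shift_prod p e o n).
Proof.
move=> nk; rewrite /shift_prod rmorphB !rmorph_sum mulrBr !mulr_sumr /=.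
congr (_ - _); apply: eq_bigr => i _.
  rewrite rmorphM !rmorphD !rmorphM !rmorph_nat /=.
  by rewrite !pE ?eE; [ring| | | |]; have := ltn_ord i; lia.
by rewrite rmorphM /= !oE; [ring| |]; have := ltn_ord i; lia.
Qed.

Lemma shift_defect_scale :
  shift_defect p' e' o' k = v ^+ 2 * f (shift_defect p e o k).
Proof.
rewrite /shift_defect rmorph_sum mulr_sumr; apply: eq_bigr => i _.
rewrite rmorphB rmorphD !rmorphM !rmorph_nat /=.
by rewrite pE ?oE ?eE; [ring| | | | |]; have := ltn_ord i; lia.
Qed.

End ScaledMorphism.

(** * Degree bounds with a prescribed top coefficient *)

Section LeadingCoefficients.
Variable R : fieldType.
Implicit Types (p q : {poly R}) (a b : R) (d : nat).

(** The value [a = 0] is allowed, so that terms of lower degree enter the same calculus as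
    negligible summands. *)
Definition lead_at d a p := (size p <= d.+1)%N /\ p`_d = a.

Lemma lead_at_lt d p : (size p <= d)%N -> lead_at d 0 p.
Proof. by move=> pd; split; [apply: leqW|apply: nth_default]. Qed.

Lemma lead_atD d a b p q : lead_at d a p -> lead_at d b q -> lead_at d (a + b) (p + q).
Proof.
move=> [pd pa] [qd qb]; split; last by rewrite coefD pa qb.
by rewrite (leq_trans (size_polyD _ _)) // geq_max pd qd.
Qed.

Lemma lead_atZ d a c p : lead_at d a p -> lead_at d (c * a) (c *: p).
Proof.
by move=> [pd pa]; split; [exact: leq_trans (size_scale_leq _ _) pd|rewrite coefZ pa].
Qed.

Lemma lead_at_natM n d a p : lead_at d a p -> lead_at d (n%:R * a) (n%:R * p).
Proof. by rewrite [n%:R * p]mulr_natl -scaler_nat; apply: lead_atZ. Qed.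

Lemma lead_atB d a b p q : lead_at d a p -> lead_at d b q -> lead_at d (a - b) (p - q).
Proof.
move=> pa /(lead_atZ (-1)) qb.
by have := lead_atD pa qb; rewrite scaleN1r mulN1r.
Qed.

Lemma lead_atM i j d a b p q : d = (i + j)%N ->
  lead_at i a p -> lead_at j b q -> lead_at d (a * b) (p * q).
Proof.
move=> -> [pi pa] [qj qb]; split.
  by apply: leq_trans (size_polyMleq _ _) _; lia.
rewrite coefM (bigD1 (inord i)) //= inordK; last lia.
rewrite pa addKn qb big1 ?addr0 // => l li.
have {}li : l != i :> nat by apply: contra li => /eqP li; apply/eqP/val_inj; rewrite /= inordK //; lia.
have [il|il] := ltnP i l; first by rewrite [p`_l]nth_default ?mul0r //; exact: leq_trans pi il.
rewrite [q`_ _]nth_default ?mulr0 //; apply: leq_trans qj _; lia.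
Qed.

Lemma lead_at_sum d (n : nat) (F : nat -> {poly R}) (a : nat -> R) :
  (forall i, (i < n)%N -> lead_at d (a i) (F i)) ->
  lead_at d (\sum_(i < n) a i) (\sum_(i < n) F i).
Proof.
elim: n => [|n IHn] Fa.
  by rewrite !big_ord0; apply: lead_at_lt; rewrite size_poly0.
rewrite !big_ord_recr; apply: lead_atD; last exact: Fa.
by apply: IHn => i /ltnW; apply: Fa.
Qed.

Lemma size_sum_le d (n : nat) (F : nat -> {poly R}) :
  (forall i, (i < n)%N -> (size (F i) <= d)%N) ->
  (size (\sum_(i < n) F i)%R <= d)%N.
Proof.
move=> Fd; apply: leq_trans (size_sum _ _ _) _.
by apply/bigmax_leqP => i _; apply: Fd.
Qed.

End LeadingCoefficients.

(** * The polynomial recursion for [P_k] and its top degree *)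

Section Recursion.
Variables (R : numFieldType) (rc : R) (r : nat -> R).
(* [Pd l n] stands for the n-th x-derivative of [P_l]. In [P(x + c eps) - P(x)]
   with [c = 1] or [-1], the coefficients of [eps^(2i)] and [eps^(2i+1)] are
   [even_shift i] and [c * odd_shift i]. *)
Variable Pd : nat -> nat -> {poly R}.

Definition even_shift i : {poly R} :=
  \sum_(l < i) ((2 * i - 2 * l)`!%:R^-1 *: Pd l (2 * i - 2 * l)).
Definition odd_shift i : {poly R} :=
  \sum_(l < i.+1) (((2 * i).+1 - 2 * l)`!%:R^-1 *: Pd l ((2 * i).+1 - 2 * l)).

Let P l := Pd l 0%N.
Let e := even_shift.
Let o := odd_shift.

(* Coefficient of [eps^(2k)] in [r (P + P_-) (P + P_+) - 4 rc P^2]. *)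
Definition next_rhs k : {poly R} := rc *: shift_defect P e o k
  + \sum_(a < k) r a.+1 *: shift_prod P e o (k - a.+1).

(** Solution for [P_k] of the equation of order [eps^(2k)], which reads
    [2 P_k + Cauchy_mid P k = s next_rhs] because [P_0 = 1]; the variable ['X] stands for [s]. *)
Definition next_poly k : {poly R} :=
  2^-1 *: ('X * next_rhs k - Cauchy_mid P k).

Variables (k : nat) (rho rho1 rho2 : nat -> R).
Hypotheses (Pd_size : forall l n, (l < k)%N -> (size (Pd l n) <= l.+1)%N)
  (Pd0 : forall l, (l < k)%N -> (Pd l 0)`_l = rho l)
  (Pd1 : forall l, (l < k)%N -> (Pd l 1)`_l = rho1 l)
  (Pd2 : forall l, (l < k)%N -> (Pd l 2)`_l = rho2 l).

(** [Pd l n] has degree at most [l] for every [n]. Only [l = j] reaches degree [j], and it comes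
    with exactly two derivatives and the Taylor factor [1/2!]. *)
Lemma lead_even_shift j : (j < k)%N -> lead_at j (2^-1 * rho2 j) (e j.+1).
Proof.
move=> jk; rewrite /e /even_shift big_ord_recr /= -[X in lead_at _ X _]add0r.
apply: lead_atD.
  apply: lead_at_lt; apply: (size_sum_le
    (F := fun l => (2 * j.+1 - 2 * l)`!%:R^-1 *: Pd l (2 * j.+1 - 2 * l))) => l lj.
  by apply: leq_trans (size_scale_leq _ _) _; apply: leq_trans (Pd_size _ _) _; lia.
rewrite (_ : (2 * j.+1 - 2 * j)%N = 2%N); last lia.
by apply: lead_atZ; split; [exact: Pd_size|exact: Pd2].
Qed.

Lemma size_even_shift i : (i <= k)%N -> (size (e i) <= i)%N.
Proof.
case: i => [_|i ik]; last exact: (lead_even_shift ik).1.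
by rewrite /e /even_shift big_ord0 size_poly0.
Qed.

Lemma lead_odd_shift j : (j < k)%N -> lead_at j (rho1 j) (o j).
Proof.
move=> jk; rewrite /o /odd_shift big_ord_recr /= -[X in lead_at _ X _]add0r.
apply: lead_atD.
  apply: lead_at_lt; apply: (size_sum_le
    (F := fun l => ((2 * j).+1 - 2 * l)`!%:R^-1 *: Pd l ((2 * j).+1 - 2 * l))) => l lj.
  by apply: leq_trans (size_scale_leq _ _) _; apply: leq_trans (Pd_size _ _) _; lia.
rewrite (_ : ((2 * j).+1 - 2 * j)%N = 1%N); last lia.
rewrite invr1 scale1r.
by split; [exact: Pd_size|exact: Pd1].
Qed.

Lemma lead_P l : (l < k)%N -> lead_at l (rho l) (P l).
Proof. by move=> lk; split; [exact: Pd_size|exact: Pd0]. Qed.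

Lemma lead_shift_prod n : (n < k)%N ->
  lead_at n (\sum_(i < n.+1) 4 * (rho i * rho (n - i)%N)) (shift_prod P e o n).
Proof.
move=> nk; rewrite /shift_prod -[X in lead_at _ X _]subr0; apply: lead_atB.
  have two i : (i <= n)%N -> lead_at i (2 * rho i) (2 * P i + e i).
    move=> i_n; rewrite -[X in lead_at _ X _]addr0; apply: lead_atD.
      by apply: (lead_at_natM 2); apply: lead_P; lia.
    by apply: lead_at_lt; apply: size_even_shift; lia.
  apply: (lead_at_sum (F := fun i => (2 * P i + e i) * (2 * P (n - i)%N + e (n - i)%N))
    (a := fun i => 4 * (rho i * rho (n - i)%N))) => i i_n.
  rewrite (_ : 4 * _ = (2 * rho i) * (2 * rho (n - i)%N)); last by ring.
  by apply: (@lead_atM _ i (n - i)); [lia|apply: two; lia|apply: two; lia].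
apply: lead_at_lt; apply: (size_sum_le (F := fun i => o i * o (n - i.+1)%N)) => i i_n.
have /lead_odd_shift[oi _] : (i < k)%N by lia.
have /lead_odd_shift[oni _] : (n - i.+1 < k)%N by lia.
by apply: leq_trans (size_polyMleq _ _) _; lia.
Qed.

(** Since [e i] has degree below [i], products of two even shifts stay below degree [k - 1]. The
    mixed term leaves [4 rho (rho2 / 2)] and the odd parts leave [- rho1 rho1]. *)
Lemma lead_shift_defect : (0 < k)%N ->
  lead_at k.-1 (\sum_(i < k) (2 * rho i * rho2 (k - i.+1)%N - rho1 i * rho1 (k - i.+1)%N))
    (shift_defect P e o k).
Proof.
move=> k0; rewrite /shift_defect.
apply: (lead_at_sum (F := fun i => 4 * (P i * e (k - i)%N) + e i * e (k - i)%N
                - o i * o (k - i.+1)%N)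
  (a := fun i => 2 * rho i * rho2 (k - i.+1)%N - rho1 i * rho1 (k - i.+1)%N)) => i ik.
apply: lead_atB.
  rewrite -[X in lead_at _ X _]addr0; apply: lead_atD.
    rewrite (_ : _ * _ * _ = 4%:R * (rho i * (2^-1 * rho2 (k - i.+1)%N))); last by field.
    apply: (lead_at_natM 4); apply: (@lead_atM _ i (k - i.+1)); [lia|exact: lead_P|].
    rewrite (_ : (k - i)%N = (k - i.+1).+1); last lia.
    by apply: lead_even_shift; lia.
  apply: lead_at_lt; apply: leq_trans (size_polyMleq _ _) _.
  have := @size_even_shift i (ltnW ik); have := @size_even_shift (k - i) (leq_subr _ _).
  by move: (size (e i)) (size (e (k - i))) => a b; lia.
by apply: (@lead_atM _ i (k - i.+1)); [lia|apply: lead_odd_shift; lia|apply: lead_odd_shift; lia].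
Qed.

Lemma lead_next_poly : (0 < k)%N ->
  lead_at k (2^-1 * (\sum_(i < k) (4 * r 1 * (rho i * rho (k - i.+1)%N)
     + rc * (2 * rho i * rho2 (k - i.+1)%N - rho1 i * rho1 (k - i.+1)%N))
     - Cauchy_mid rho k)) (next_poly k).
Proof.
move=> k0; apply: lead_atZ; apply: lead_atB; last first.
  apply: (lead_at_sum (F := fun i => P i.+1 * P (k - i.+1)%N)
     (a := fun i => rho i.+1 * rho (k - i.+1)%N)) => i ik.
  by apply: (@lead_atM _ i.+1 (k - i.+1)); [lia|apply: lead_P; lia|apply: lead_P; lia].
rewrite -[X in lead_at _ X _]mul1r; apply: (@lead_atM _ 1 k.-1); first lia.
  by split; rewrite ?size_polyX ?coefX.
rewrite big_split /= addrC; apply: lead_atD.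
  by rewrite -mulr_sumr; apply: lead_atZ; apply: lead_shift_defect.
set S := \sum_(i < k) _.
(* [r a.+1] multiplies a polynomial of degree at most [k - a - 1], so in degree [k - 1] only [a = 0]
   contributes. *)
have -> : S = \sum_(a < k) if a == 0%N :> nat then S else 0.
  rewrite (bigD1 (Ordinal k0)) //= big1 ?addr0 // => a.
  by rewrite -val_eqE /= => /negbTE ->.
apply: (lead_at_sum (F := fun a => r a.+1 *: shift_prod P e o (k - a.+1))
  (a := fun a => if a == 0%N then S else 0)) => a ak.
have [a0|a0] := eqVneq a 0%N.
  rewrite a0 subn1; have k1 : (k.-1 < k)%N by rewrite prednK.
  have := lead_atZ (r 1) (lead_shift_prod k1); congr lead_at.
  rewrite mulr_sumr /S prednK //; apply: eq_bigr => i _.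
  rewrite (_ : (k.-1 - i)%N = (k - i.+1)%N); [ring|lia].
apply: lead_at_lt; apply: leq_trans (size_scale_leq _ _) _.
have /lead_shift_prod[+ _] : (k - a.+1 < k)%N by lia.
by move=> /leq_trans; apply; lia.
Qed.

(** The factor ['X] kills one part, and [Cauchy_mid] has only positive indices. As a result [W]
    itself, which need not vanish at [rc], stays out of the final sum. *)
Lemma next_poly_coef0 : (forall l, (0 < l < k)%N -> (Pd l 0)`_0 = 0) ->
  (next_poly k)`_0 = 0.
Proof.
move=> P0; rewrite /next_poly coefZ coefB coefXM /= sub0r /Cauchy_mid coef_sum.
rewrite big1 ?oppr0 ?mulr0 // => i _.
by rewrite coef0M P0 ?mul0r //; have := ltn_ord i; lia.
Qed.

End Recursion.

(** * Separation of even and odd powers of [eps] *)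

Section ExpansionInS.
Variable R : realType.

Definition ev (s : R[i]) : {rmorphism {poly R} -> R[i]} :=
  horner_eval s \o map_poly (real_complex R).

Lemma evZ s c p : ev s (c *: p) = c%:C * ev s p.
Proof. by rewrite /ev /= map_polyZ /horner_eval hornerZ. Qed.

Lemma evX s : ev s 'X = s.
Proof. by rewrite /ev /= map_polyX /horner_eval hornerX. Qed.

Lemma ev_poly s (v : R[i]) d (c : nat -> R) :
  v * ev s (\poly_(j < d) c j) = \sum_(j < d) (c j)%:C * (v * s ^+ j).
Proof.
rewrite poly_def rmorph_sum mulr_sumr; apply: eq_bigr => j _.
by rewrite evZ rmorphXn evX; ring.
Qed.

Lemma sum_even_odd (V : nmodType) (F : nat -> V) n :
  \sum_(i < (2 * n).+1) F i =
  \sum_(i < n.+1) F (2 * i)%N + \sum_(i < n) F (2 * i).+1.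
Proof.
elim: n => [|n IHn]; first by rewrite !big_ord_recr !big_ord0 /= addr0.
rewrite mulnS !addSn add0n big_ord_recr big_ord_recr IHn /=.
rewrite [in RHS]big_ord_recr [X in _ = _ + X]big_ord_recr /=.
rewrite (_ : (2 * n.+1)%N = (2 * n).+2); last by rewrite mulnS.
by rewrite -!addrA; congr (_ + _); rewrite addrA [RHS]addrC.
Qed.

Lemma sprod_even (a b : nat -> R[i]) n : (forall i, a (2 * i).+1 = 0) ->
  sprod a b (2 * n) = \sum_(i < n.+1) a (2 * i)%N * b (2 * (n - i))%N.
Proof.
move=> a0; rewrite /sprod (sum_even_odd (fun i => a i * b (2 * n - i)%N)).
rewrite [X in _ + X]big1 ?addr0; last by move=> i _; rewrite a0 mul0r.
by apply: eq_bigr => i _; rewrite mulnBr.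
Qed.

(** The term [4 r_0 \sum u_i u_(k-i)] is moved to the side of [lam]; this produces the factor
    [lam - 4 rc] and leaves a right side free of [u k]. *)
Lemma string_equation_even (r u e o rs us sm sp : nat -> R[i]) (lam : R[i]) k :
  (0 < k)%N -> e 0%N = 0 ->
  (forall i, rs (2 * i)%N = r i) -> (forall i, rs (2 * i).+1 = 0) ->
  (forall i, us (2 * i)%N = u i) -> (forall i, us (2 * i).+1 = 0) ->
  (forall i, sm (2 * i)%N = 2 * u i + e i) -> (forall i, sm (2 * i).+1 = - o i) ->
  (forall i, sp (2 * i)%N = 2 * u i + e i) -> (forall i, sp (2 * i).+1 = o i) ->
  sprod rs (sprod sm sp) (2 * k) = lam * sprod us us (2 * k) ->
  (lam - 4 * r 0%N) * (2 * (u 0%N * u k) + Cauchy_mid u k) =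
  r 0%N * shift_defect u e o k
  + \sum_(a < k) r a.+1 * shift_prod u e o (k - a.+1).
Proof.
move=> k0 e0 rE rO uE uO smE smO spE spO.
have smp n : sprod sm sp (2 * n) = shift_prod u e o n.
  rewrite /sprod (sum_even_odd (fun i => sm i * sp (2 * n - i)%N)) /shift_prod.
  congr (_ + _).
    by apply: eq_bigr => i _; rewrite -mulnBr smE spE.
  rewrite -sumrN; apply: eq_bigr => i _.
  rewrite smO (_ : (2 * n - (2 * i).+1)%N = (2 * (n - i.+1)).+1); last first.
    by have := ltn_ord i; lia.
  by rewrite spO mulNr.
rewrite !sprod_even // => H.
have {}H : \sum_(i < k.+1) r i * shift_prod u e o (k - i) =
    lam * \sum_(i < k.+1) u i * u (k - i)%N.
  move: H; under eq_bigr => i _ do rewrite rE smp.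
  by under [in RHS]eq_bigr => i _ do rewrite !uE.
move: H; rewrite big_ord_recl /= subn0 shift_prodE // Cauchy_midE // => H.
rewrite mulrBl -H; ring.
Qed.

End ExpansionInS.

(** * Polynomials whose coefficients are smooth in x *)

Section SmoothPolynomials.
Variables (R : realType) (I : set R).
Hypothesis oI : open I.

Definition smooth_poly (F : R -> {poly R}) :=
  forall j, smooth_on I (fun x => (F x)`_j).

Lemma smooth_poly_cst p : smooth_poly (fun=> p).
Proof. by move=> j; apply: smooth_on_cst. Qed.

Lemma smooth_polyD F G : smooth_poly F -> smooth_poly G ->
  smooth_poly (fun x => F x + G x).
Proof.
move=> sF sG j; apply: (smooth_on_open_eq oI _ (smooth_onD oI (sF j) (sG j))).
by move=> y _; rewrite coefD.
Qed.

Lemma smooth_polyZ c F : smooth_on I c -> smooth_poly F ->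
  smooth_poly (fun x => c x *: F x).
Proof.
move=> sc sF j; apply: (smooth_on_open_eq oI _ (smooth_onM oI sc (sF j))).
by move=> y _; rewrite coefZ.
Qed.

Lemma smooth_polyB F G : smooth_poly F -> smooth_poly G ->
  smooth_poly (fun x => F x - G x).
Proof.
move=> sF /(smooth_polyZ (@smooth_on_cst _ _ oI (-1))) sG j.
have := @smooth_polyD _ _ sF sG j; apply: smooth_on_open_eq => // y _ /=.
by rewrite scaleN1r.
Qed.

Lemma smooth_polyM F G : smooth_poly F -> smooth_poly G ->
  smooth_poly (fun x => F x * G x).
Proof.
move=> sF sG j.
apply: (@smooth_on_open_eq _ _ oI (fun x => \sum_(i < j.+1) (F x)`_i * (G x)`_(j - i))).
  by move=> y _; rewrite coefM.
by apply: smooth_on_sum => // i _; apply: smooth_onM.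
Qed.

Lemma smooth_poly_sum n (F : 'I_n -> R -> {poly R}) :
  (forall i, smooth_poly (F i)) -> smooth_poly (fun x => \sum_(i < n) F i x).
Proof.
move=> sF j.
apply: (@smooth_on_open_eq _ _ oI (fun x => \sum_(i < n) (F i x)`_j)).
  by move=> y _; rewrite coef_sum.
by apply: smooth_on_sum => // i _; apply: sF.
Qed.

Lemma smooth_next_poly rc (r : nat -> R -> R) (Pd : R -> nat -> nat -> {poly R}) k :
  (forall a, smooth_on I (r a.+1)) ->
  (forall l n, smooth_poly (fun x => Pd x l n)) ->
  smooth_poly (fun x => next_poly rc (r^~ x) (Pd x) k).
Proof.
move=> sr sP.
have se i : smooth_poly (fun x => even_shift (Pd x) i).
  apply: smooth_poly_sum => l.
  by apply: (@smooth_polyZ (cst _)); [exact: smooth_on_cst|exact: sP].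
have so i : smooth_poly (fun x => odd_shift (Pd x) i).
  apply: smooth_poly_sum => l.
  by apply: (@smooth_polyZ (cst _)); [exact: smooth_on_cst|exact: sP].
have s2P i : smooth_poly (fun x => 2 * Pd x i 0%N + even_shift (Pd x) i).
  apply: smooth_polyD (se i).
  by apply: (@smooth_polyM (fun=> 2)); [exact: smooth_poly_cst|exact: sP].
apply: (@smooth_polyZ (cst 2^-1)); first exact: smooth_on_cst.
apply: smooth_polyB; last first.
  by apply: smooth_poly_sum => i; apply: smooth_polyM; apply: sP.
apply: (@smooth_polyM (fun=> 'X)); first exact: smooth_poly_cst.
apply: smooth_polyD.
  apply: (@smooth_polyZ (cst rc)); first exact: smooth_on_cst.
  apply: smooth_poly_sum => i; apply: smooth_polyB (smooth_polyM (so _) (so _)).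
  apply: smooth_polyD (smooth_polyM (se _) (se _)).
  apply: (@smooth_polyM (fun=> 4)); first exact: smooth_poly_cst.
  exact: smooth_polyM (sP _ _) (se _).
apply: smooth_poly_sum => a; apply: smooth_polyZ; first exact: sr.
apply: smooth_polyB; apply: smooth_poly_sum => i.
  exact: smooth_polyM (s2P _) (s2P _).
exact: smooth_polyM (so _) (so _).
Qed.

End SmoothPolynomials.

(** * Every [U^[k]] is [U0] times a polynomial in [s] *)

Section Expansion.
Variables (R : realType) (rc : R) (I : set R) (rk : nat -> R -> R).
Variables (U : nat -> R[i] -> R -> R[i]) (m : nat) (Rs : nat -> dpoly R (nGD m)).
Variable x0 : R.
Hypotheses (rc0 : 0 < rc) (oI : open I) (iI : is_interval I) (x0I : I x0).
Hypothesis rk_smooth : forall k, (1 <= k)%N -> smooth_on I (rk k).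
Hypothesis U0_smooth :
  forall lam, 4 * rc < normc lam -> csmooth_on I (fun x => U 0%N lam x).
Hypothesis U0_sqr : forall x lam, I x -> 4 * rc < normc lam ->
  U 0%N lam x ^+ 2 * (lam - (4 * rc)%:C) = lam.
Hypothesis U_eq : forall x lam N, I x -> 4 * rc < normc lam ->
  sprod (rser rc rk x)
    (sprod (fun n => User U lam x n + Ushift U lam x (-1) n)
           (fun n => User U lam x n + Ushift U lam x 1 n)) N
  = lam * (sprod (User U lam x) (User U lam x) N - (N == 0%N)%:R).
Hypothesis RsP : GD_family rc Rs.

Let u := rk 1%N.
Let s (lam : R[i]) := (lam - (4 * rc)%:C)^-1.
Let v (lam : R[i]) := U 0%N lam x0.

Lemma lam_neq0 lam : 4 * rc < normc lam -> lam != 0.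
Proof.
apply: contraTneq => ->; rewrite /normc /= expr0n /= addr0 sqrtr0 -leNgt.
by rewrite mulr_ge0 // ltW.
Qed.

Lemma lam_sub_neq0 lam : 4 * rc < normc lam -> lam - (4 * rc)%:C != 0.
Proof.
move=> hl; apply: contra (lam_neq0 hl) => /eqP d0.
by rewrite -(U0_sqr x0I hl) d0 mulr0.
Qed.

Lemma v_neq0 lam : 4 * rc < normc lam -> v lam != 0.
Proof.
move=> hl; apply: contra (lam_neq0 hl) => /eqP d0.
by rewrite -(U0_sqr x0I hl) -/(v lam) d0 expr0n mul0r.
Qed.

(** Once the branch is constant in x, Taylor shifts pass through the factor [v] and act on the
    polynomials in [s] only. *)
Lemma U0_cst x lam : I x -> 4 * rc < normc lam -> U 0%N lam x = v lam.
Proof.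
move=> Ix hl; have d0 := lam_sub_neq0 hl.
apply: (@csqrt_cst _ _ oI (U 0%N lam) (lam / (lam - (4 * rc)%:C))) => //.
- exact: U0_smooth.
- by rewrite mulf_neq0 ?invr_eq0 // lam_neq0.
- by move=> y Iy; apply: (mulIf d0); rewrite U0_sqr // divfK.
- by rewrite inE.
- by rewrite inE.
Qed.

Lemma UshiftE lam x c N : Ushift U lam x c N =
  \sum_(l < N./2.+1) cderiv (N - 2 * l) (U l lam) x
     * (c ^+ (N - 2 * l) / (N - 2 * l)`!%:R)%:C.
Proof. by []. Qed.

Definition even_jet lam x i : R[i] :=
  \sum_(l < i) cderiv (2 * i - 2 * l) (U l lam) x * ((2 * i - 2 * l)`!%:R^-1)%:C.

Definition odd_jet lam x i : R[i] :=
  \sum_(l < i.+1) cderiv ((2 * i).+1 - 2 * l) (U l lam) x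
     * (((2 * i).+1 - 2 * l)`!%:R^-1)%:C.

Lemma Ushift_even lam x c i : c ^+ 2 = 1 ->
  Ushift U lam x c (2 * i) = U i lam x + even_jet lam x i.
Proof.
move=> c2; have ce j : c ^+ (2 * i - 2 * j) = 1.
  by rewrite -mulnBr exprM c2 expr1n.
rewrite UshiftE mul2n doubleK -mul2n big_ord_recr /= addrC; congr (_ + _).
  rewrite ce subnn fact0 divr1 mulr1 /cderiv !derive1n0.
  by case: (U i lam x).
by apply: eq_bigr => j _; rewrite ce div1r.
Qed.

Lemma Ushift_odd lam x c i : c ^+ 2 = 1 ->
  Ushift U lam x c (2 * i).+1 = c%:C * odd_jet lam x i.
Proof.
move=> c2; rewrite UshiftE (_ : (2 * i).+1./2 = i); last lia.
rewrite mulr_sumr; apply: eq_bigr => j _; rewrite mulrCA -rmorphM; congr (_ * _%:C).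
have ji := ltn_ord j; rewrite (_ : ((2 * i).+1 - 2 * j)%N = (2 * (i - j)).+1); last lia.
by rewrite exprS exprM c2 expr1n mulr1.
Qed.

(** Invariant of the induction on [k]. The [b j] are real and independent of [lam], and their
    smoothness feeds the later Taylor shifts. The last clause stops at [m], as does the recursion in
    [GD_family]. *)
Definition expands k (b : nat -> R -> R) := [/\
  forall j, smooth_on I (b j),
  forall x lam, I x -> 4 * rc < normc lam ->
    U k lam x = v lam * ev (s lam) (\poly_(j < k.+1) b j x),
  forall x, I x -> b 0%N x = (k == 0%N)%:R &
  (k <= m)%N -> forall x, I x -> b k x = deval (Rs k) u x].

Lemma expands0 : exists b, expands 0 b.
Proof.
exists (fun=> cst 1); split.
- by move=> j; apply: smooth_on_cst.
- move=> x lam Ix hl; rewrite U0_cst // (_ : \poly_(_ < _) _ = 1) ?rmorph1 ?mulr1 //.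
  by rewrite poly_def big_ord_recr big_ord0 /= add0r expr0 scale1r.
- by move=> x _; rewrite eqxx.
- by move=> _ x _; have [-> _ _ _] := RsP; rewrite /deval meval1.
Qed.

Section Step.
Variables (k : nat) (B : nat -> nat -> R -> R).
Hypotheses (k0 : (0 < k)%N) (B_smooth : forall l j, smooth_on I (B l j)).
Hypothesis B_exp : forall l, (l < k)%N -> expands l (B l).

Let Pd x l n : {poly R} := \poly_(j < l.+1) derive1n n (B l j) x.

Lemma cderiv_Pd x lam l n : I x -> 4 * rc < normc lam -> (l < k)%N ->
  cderiv n (U l lam) x = v lam * ev (s lam) (Pd x l n).
Proof.
move=> Ix hl lk; have [_ UE _ _] := B_exp lk.
rewrite ev_poly; apply: (@cderiv_sum R I oI l.+1 n (B l) (fun j => v lam * s lam ^+ j)) => [||//].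
  exact: B_smooth.
move=> y Iy.
by rewrite UE // ev_poly.
Qed.

(** All lower data are [v] times polynomials in [s], so the forms carry [v^2], while the unknown
    occurs as [2 v (U k)]. Dividing by [v (lam - 4 rc)] leaves the polynomial recursion. *)
Lemma next_coef x lam : I x -> 4 * rc < normc lam ->
  U k lam x = v lam * ev (s lam) (next_poly rc (rk^~ x) (Pd x) k).
Proof.
move=> Ix hl.
pose r a : R[i] := (if a == 0%N then rc else rk a x)%:C.
pose P l := Pd x l 0%N.
set W := ev (s lam) (next_poly _ _ _ _).
have half i : (2 * i)./2 = i by rewrite mul2n doubleK.
have odd2 i : odd (2 * i) = false by rewrite mul2n odd_double.
have UserE i : User U lam x (2 * i) = U i lam x by rewrite /User odd2 half.
have UserO i : User U lam x (2 * i).+1 = 0 by rewrite /User /= odd2.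
have N1 : (-1 : R) ^+ 2 = 1 by rewrite sqrrN expr1n.
have P1 : (1 : R) ^+ 2 = 1 by rewrite expr1n.
have e0 : even_jet lam x 0 = 0 by rewrite /even_jet big_ord0.
have rE i : rser rc rk x (2 * i) = r i.
  by rewrite /rser odd2 half /r muln_eq0 /=; case: eqP.
have rO i : rser rc rk x (2 * i).+1 = 0 by rewrite /rser /= odd2.
have shE c i : c ^+ 2 = 1 ->
    User U lam x (2 * i) + Ushift U lam x c (2 * i) = 2 * U i lam x + even_jet lam x i.
  by move=> c2; rewrite UserE Ushift_even //; ring.
have smO i : User U lam x (2 * i).+1 + Ushift U lam x (-1) (2 * i).+1 = - odd_jet lam x i.
  by rewrite UserO Ushift_odd // add0r rmorphN1 mulN1r.
have spO i : User U lam x (2 * i).+1 + Ushift U lam x 1 (2 * i).+1 = odd_jet lam x i.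
  by rewrite UserO Ushift_odd // add0r mul1r.
have := @string_equation_even _ r (fun i => U i lam x) (even_jet lam x) (odd_jet lam x)
  (rser rc rk x) (User U lam x) (fun n => User U lam x n + Ushift U lam x (-1) n)
  (fun n => User U lam x n + Ushift U lam x 1 n) lam k k0 e0 rE rO UserE UserO
  (fun i => shE _ i N1) smO (fun i => shE _ i P1) spO.
rewrite U_eq // muln_eq0 /= -leqn0 leqNgt k0 subr0 => /(_ erefl).
have PE i : (i < k)%N -> U i lam x = v lam * ev (s lam) (P i).
  by move=> ik; have [_ -> //] := B_exp ik.
have eE i : (i <= k)%N -> even_jet lam x i = v lam * ev (s lam) (even_shift (Pd x) i).
  move=> ik; rewrite /even_jet /even_shift rmorph_sum mulr_sumr; apply: eq_bigr => l _.
  by rewrite evZ (cderiv_Pd _ Ix hl) ?(leq_trans (ltn_ord l)) //; ring.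
have oE i : (i < k)%N -> odd_jet lam x i = v lam * ev (s lam) (odd_shift (Pd x) i).
  move=> ik; rewrite /odd_jet /odd_shift rmorph_sum mulr_sumr; apply: eq_bigr => l _.
  by rewrite evZ (cderiv_Pd _ Ix hl) ?(leq_trans (ltn_ord l)) //; ring.
rewrite (Cauchy_mid_scale (f := ev (s lam)) PE).
rewrite (shift_defect_scale (f := ev (s lam)) PE eE oE).
under eq_bigr => a _.
  rewrite (shift_prod_scale (f := ev (s lam)) PE eE oE) /r /=; last first.
    by have := ltn_ord a; lia.
  rewrite mulrCA -evZ; over.
have r0 : r 0%N = rc%:C by [].
rewrite r0 -mulr_sumr -rmorph_sum [rc%:C * (_ * _)]mulrCA -evZ -mulrDr -rmorphD.
rewrite -/(next_rhs rc (rk^~ x) (Pd x) k) (U0_cst Ix hl).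
have v0 := v_neq0 hl; have d0 := lam_sub_neq0 hl.
rewrite /W /next_poly evZ rmorphB rmorphM evX.
move: (ev _ _) (ev _ _) => N C H.
have {}H : 2 * U k lam x + v lam * C = v lam * (s lam * N).
  apply: (mulfI d0); apply: (mulfI v0).
  rewrite [X in _ = X](_ : _ = v lam ^+ 2 * N); last first.
    transitivity (v lam ^+ 2 * ((lam - (4 * rc)%:C) * s lam) * N); first by ring.
    by rewrite mulfV // mulr1.
  by rewrite -H rmorphM rmorph_nat; ring.
apply: (mulfI (_ : 2 != 0 :> R[i])); first by rewrite pnatr_eq0.
rewrite (_ : 2 * U k lam x = v lam * (s lam * N) - v lam * C); last by rewrite -H; ring.
by rewrite fmorphV rmorph_nat; field.
Qed.

(** [lead_next_poly] and [GD_quadratic], solved for [Rs k] with [Rs 0 = 1], are the same recursion.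
    The lower equalities hold on all of [I], so they may be differentiated, and two applications of
    [Dx] stay below the top variable. *)
Lemma next_lead x : I x -> (k <= m)%N ->
  (next_poly rc (rk^~ x) (Pd x) k)`_k = deval (Rs k) u x.
Proof.
move=> Ix km.
have uS : smooth_on I u by apply: rk_smooth.
have ud y : I y -> forall n, derivable (derive1n n u) y 1.
  by move=> Iy n; apply: uS.
have Rs_top l d : (l < k)%N -> (d <= 2)%N -> no_top (iter d (@Dx R (nGD m)) (Rs l)).
  move=> lk d2 i iS; suff H : vars_lt (2 * l + d) (iter d (@Dx R (nGD m)) (Rs l)).
    by apply: H; move: iS; rewrite /nGD; lia.
  elim: d {d2} => [|d IHd]; first by rewrite addn0; apply: (GD_vars_lt RsP); lia.
  by rewrite addnS; apply: vars_lt_Dx.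
have BE d l y : I y -> (l < k)%N -> (d <= 2)%N ->
    derive1n d (B l l) y = deval (iter d (@Dx R (nGD m)) (Rs l)) u y.
  move=> + lk; elim: d y => [|d IHd] y Iy d2.
    by have [_ _ _ BD] := B_exp lk; rewrite derive1n0 BD //; lia.
  rewrite derive1nS derive1E (@near_eq_derive _ _ _ _
    (deval (iter d (@Dx R (nGD m)) (Rs l)) u) y); last first.
    by apply: (near_open oI Iy) => z Iz; apply: IHd => //; lia.
  by rewrite -derive1E (derive1_deval (ud y Iy) (Rs_top _ _ lk _)).2 //; lia.
have PdE d l : (l < k)%N -> (d <= 2)%N ->
    (Pd x l d)`_l = deval (iter d (@Dx R (nGD m)) (Rs l)) u x.
  by move=> lk d2; rewrite coef_poly ltnSn BE.
have [|||||_ ->] := @lead_next_poly R rc (rk^~ x) (Pd x) k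
  (fun l => deval (Rs l) u x) (fun l => deval (Dx (Rs l)) u x)
  (fun l => deval (Dx (Dx (Rs l))) u x).
- by move=> l n _; apply: size_poly.
- by move=> l lk; apply: (PdE 0%N).
- by move=> l lk; apply: (PdE 1%N).
- by move=> l lk; apply: (PdE 2%N).
- exact: k0.
have kk : (0 < k <= m)%N by rewrite k0 km.
have devalM (P Q : dpoly R (nGD m)) : deval (P * Q) u x = deval P u x * deval Q u x by exact: mevalM.
have devalD (P Q : dpoly R (nGD m)) : deval (P + Q) u x = deval P u x + deval Q u x by exact: mevalD.
have devalB (P Q : dpoly R (nGD m)) : deval (P - Q) u x = deval P u x - deval Q u x by exact: mevalB.
have devalC c : deval (Pilot.Defs.dcst (nGD m) c) u x = c by exact: mevalC.
have devalS n (F : 'I_n -> dpoly R (nGD m)) :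
    deval (\sum_(i < n) F i) u x = \sum_(i < n) deval (F i) u x.
  exact: (big_morph (fun P => deval P u x) devalD (meval0 _)).
have devalu : deval (dvar R (inord 0 : 'I_(nGD m))) u x = u x.
  by rewrite /deval mevalXU inordK // derive1n0.
have /(congr1 (fun P => deval P u x)) := GD_quadratic RsP kk.
rewrite !devalS; under eq_bigr => i _ do rewrite devalM.
rewrite (@Cauchy_midE _ (fun l => deval (Rs l) u x) k k0) /=.
have -> : deval (Rs 0%N) u x = 1 by have [-> _ _ _] := RsP; exact: meval1.
rewrite mul1r => H.
apply: (mulfI (_ : 2 != 0 :> R)); first by rewrite pnatr_eq0.
rewrite mulrA mulfV ?pnatr_eq0 // mul1r; apply/eqP; rewrite subr_eq; apply/eqP.
rewrite H; apply: eq_bigr => i _.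
by rewrite !(devalB, devalD, devalM, devalC, devalu).
Qed.

Lemma expands_next : exists b, expands k b.
Proof.
exists (fun j x => (next_poly rc (rk^~ x) (Pd x) k)`_j); split.
- apply: (@smooth_next_poly _ _ oI rc rk); first by move=> a; apply: rk_smooth.
  move=> l n j; apply: (@smooth_on_open_eq _ _ oI
    (if (j < l.+1)%N then derive1n n (B l j) else cst 0)).
    by move=> y _; rewrite coef_poly; case: ifP.
  case: ifP => _; last exact: smooth_on_cst.
  by apply: smooth_on_derive1n; apply: B_smooth.
- move=> x lam Ix hl; rewrite next_coef //; congr (_ * ev _ _).
  apply/polyP => j; rewrite coef_poly; case: ltnP => // kj.
  apply: nth_default; apply: leq_trans kj.
  (* Only the degree bound is wanted here, so the top coefficients are taken as they come. *)
  have [|||||+ _] := @lead_next_poly R rc (rk^~ x) (Pd x) k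
    (fun l => (Pd x l 0)`_l) (fun l => (Pd x l 1)`_l) (fun l => (Pd x l 2)`_l) => //.
  by move=> l n _; apply: size_poly.
- move=> x Ix; rewrite (gtn_eqF k0); apply: next_poly_coef0 => l /andP[l0 lk].
  rewrite /Pd coef_poly /=; have [_ _ B0 _] := B_exp lk.
  by rewrite B0 // (gtn_eqF l0).
- by move=> km x Ix; apply: next_lead.
Qed.

End Step.
Lemma expandsP k : exists b, expands k b.
Proof.
elim/ltn_ind: k => k IHk; have [->|k0] := posnP k; first exact: expands0.
(* Indices [l >= k] receive the zero family, so that smoothness holds for every [l]. *)
have /choice[B BP] : forall l, exists b, (forall j, smooth_on I (b j)) /\
    ((l < k)%N -> expands l b).
  move=> l; have [lk|lk] := ltnP l k.
    by have [b bP] := IHk l lk; exists b; split=> //; case: bP.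
  by exists (fun=> cst 0); split=> // j; apply: smooth_on_cst.
by apply: (@expands_next k B k0) => l; have [] := BP l.
Qed.

End Expansion.

(** * The real-valued complex modulus *)

Section ComplexNorm.
Variable R : realType.
Implicit Types (z w : R[i]) (c : R).

Lemma normcE z : (normc z)%:C = `|z|.
Proof. by rewrite normc_def. Qed.

Lemma normc_ge0 z : 0 <= normc z.
Proof. exact: sqrtr_ge0. Qed.

Lemma normcM z w : normc (z * w) = normc z * normc w.
Proof. by apply: complexI; rewrite rmorphM /= !normcE normrM. Qed.

Lemma normcD_le z w : normc (z + w) <= normc z + normc w.
Proof. by rewrite -lecR rmorphD /= !normcE ler_normD. Qed.

Lemma normcN z : normc (- z) = normc z.
Proof. by apply: complexI; rewrite !normcE normrN. Qed.

Lemma normcB_le z w : normc (z - w) <= normc z + normc w.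
Proof. by rewrite -[normc w]normcN normcD_le. Qed.

Lemma normcX z n : normc (z ^+ n) = normc z ^+ n.
Proof. by apply: complexI; rewrite rmorphXn /= !normcE normrX. Qed.

Lemma normcV z : normc z^-1 = (normc z)^-1.
Proof. by apply: complexI; rewrite fmorphV /= !normcE normfV. Qed.

Lemma normc_real c : normc c%:C = `|c|.
Proof. by rewrite /normc /= expr0n addr0 sqrtr_sqr. Qed.

Lemma normc_nat n : normc (n%:R : R[i]) = n%:R.
Proof. by rewrite -(rmorph_nat (real_complex R)) normc_real ger0_norm. Qed.

Lemma normc_gt0 z : (0 < normc z) = (z != 0).
Proof. by rewrite -ltcR normcE normr_gt0. Qed.

Lemma normc0_eq0 z : normc z = 0 -> z = 0.
Proof. by move=> z0; apply/normr0_eq0; rewrite -normcE z0. Qed.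

Lemma normc_sum_le n (F : 'I_n -> R[i]) :
  normc (\sum_(i < n) F i) <= \sum_(i < n) normc (F i).
Proof.
by rewrite -lecR rmorph_sum normcE (le_trans (ler_norm_sum _ _ _)) //;
  apply: ler_sum => i _; rewrite -normcE.
Qed.

Lemma ev_bound (q : {poly R}) :
  exists2 C, 0 <= C & forall w, normc w <= 1 -> normc (ev w q) <= C.
Proof.
exists (\sum_(i < size q) `|q`_i|); first by apply: sumr_ge0.
move=> w w1; rewrite -[ev w q]mul1r -{1}[q]coefK ev_poly.
apply: le_trans (normc_sum_le _) _; apply: ler_sum => i _.
rewrite normcM normc_real mul1r normcX ler_piMr // exprn_ile1 //.
exact: normc_ge0.
Qed.

End ComplexNorm.

(** * The truncated central binomial series *)

Section CentralBinomials.
Variable R : realType.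

Lemma central_binS n :
  (n.+1 * 'C(2 * n.+1, n.+1) = 2 * (2 * n).+1 * 'C(2 * n, n))%N.
Proof.
have := mul_bin_diag (2 * n.+1) n; rewrite (_ : (2 * n.+1).-1 = (2 * n).+1); last lia.
move=> <-; have := mul_bin_down (2 * n).+1 n; rewrite /=.
rewrite (_ : ((2 * n).+1 - n)%N = n.+1); last lia.
move=> H; rewrite -!mulnA H; lia.
Qed.

Definition central_poly K : {poly R} := \poly_(n < K) 'C(2 * n, n)%:R.

(* From the differential equation [(1 - 4 X) y' = 2 y] of [y = (1 - 4 X)^(-1/2)]. *)
Lemma central_poly_sqr K : exists E : {poly R},
  (1 - 4%:R *: 'X) * central_poly K.+1 ^+ 2 = 1 + E * 'X^(K.+1).
Proof.
set T := central_poly K.+1; set c : R := (2 * (2 * K).+1 * 'C(2 * K, K))%:R.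
have TC i : (i <= K)%N -> T`_i = 'C(2 * i, i)%:R by move=> iK; rewrite coef_poly ltnS iK.
have T0 i : (K < i)%N -> T`_i = 0 by move=> iK; rewrite coef_poly ltnS leqNgt iK.
(* Truncation disturbs the equation in degree [K] only; by [central_binS], [c] is the missing
   coefficient [(K+1) 'C(2K+2, K+1)]. *)
have ode : (1 - 4%:R *: 'X) * T^`() = 2%:R *: T - c *: 'X^K.
  apply/polyP => i; rewrite mulrBl mul1r -scalerAl !(coefB, coefZ, coefXM, coefXn) coef_deriv.
  rewrite (_ : (if i == 0%N then 0 else T^`()`_i.-1) = T`_i *+ i); last first.
    by case: i => [|i]; rewrite ?mulr0n //= coef_deriv.
  have [iK|Ki|iK] := ltngtP i K.
  - rewrite !TC ?mulr0 ?subr0 //; last by rewrite ltnW.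
    rewrite -[X in X - _]mulr_natl -natrM central_binS -mulr_natl !natrM; ring.
  - by rewrite !T0 ?mul0rn ?mulr0 ?subr0 //; apply: ltnW.
  - by rewrite iK TC // T0 // mul0rn /c mulr1 -mulr_natl; ring.
set D := _ * _.
(* The derivative of [D] is divisible by ['X^K], so [D] has no terms in degrees 1 to [K]. *)
have dD : deriv D = (- 2%:R * c) *: (T * 'X^K).
  have d1 : deriv (1 : {poly R}) = 0 by rewrite -polyC1 derivC.
  rewrite /D derivM derivB derivZ derivX d1 sub0r expr2 derivM.
  transitivity (2%:R *: (T * ((1 - 4%:R *: 'X) * T^`())) - 4%:R *: (T * T)).
    by rewrite -!mul_polyC; ring.
  by rewrite ode -!mul_polyC; ring.
have Di i : (0 < i <= K)%N -> D`_i = 0.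
  case: i => // i /andP[_ iK]; have := coef_deriv D i.
  rewrite dD coefZ coefMXn iK mulr0 => /esym /eqP.
  by rewrite mulrn_eq0 => /eqP.
exists (drop_poly K.+1 D); rewrite -[LHS](poly_take_drop K.+1); congr (_ + _).
apply/polyP => i; rewrite coef_take_poly coef1; case: i => [|i] /=.
  by rewrite /D coef0M expr2 coef0M coefB coef1 coefZ coefX mulr0 subr0 TC // bin0 !mulr1.
by case: ifP => // iK; rewrite Di.
Qed.

End CentralBinomials.

(** * Expansion at infinity of [U0 s^j] *)

Section Asymptotics.
Variable R : realType.
Variable rc : R.
Hypothesis rc0 : 0 < rc.

(** The error is uniform on circles, which is what a mean over a large circle requires. *)
Definition approx K (f : R[i] -> R[i]) (a : nat -> R) :=
  exists C M : R, forall lam, M < normc lam ->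
    normc (f lam - \sum_(n < K) (a n)%:C * lam^-1 ^+ n) <= C * (normc lam)^-1 ^+ K.

Lemma approxZ K f a c : approx K f a ->
  approx K (fun lam => c%:C * f lam) (fun n => c * a n).
Proof.
move=> [C [M fa]]; exists (`|c| * C), M => lam hl.
rewrite (_ : _ - _ = c%:C * (f lam - \sum_(n < K) (a n)%:C * lam^-1 ^+ n)).
  by rewrite normcM normc_real -mulrA ler_wpM2l // fa.
rewrite mulrBr mulr_sumr; congr (_ - _); apply: eq_bigr => n _.
by rewrite rmorphM mulrA.
Qed.

Lemma approxD K f g a b : approx K f a -> approx K g b ->
  approx K (fun lam => f lam + g lam) (fun n => a n + b n).
Proof.
move=> [C [M fa]] [D [N gb]]; exists (C + D), (Num.max M N) => lam.
rewrite gt_max => /andP[hM hN].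
rewrite (_ : _ - _ = (f lam - \sum_(n < K) (a n)%:C * lam^-1 ^+ n)
   + (g lam - \sum_(n < K) (b n)%:C * lam^-1 ^+ n)).
  rewrite mulrDl; apply: le_trans (normcD_le _ _) _.
  by apply: lerD; [apply: fa|apply: gb].
rewrite (eq_bigr (fun n : 'I_K => (a n)%:C * lam^-1 ^+ n + (b n)%:C * lam^-1 ^+ n)).
  by rewrite big_split /=; ring.
by move=> n _; rewrite rmorphD mulrDl.
Qed.

Lemma approx_sum K d (f : nat -> R[i] -> R[i]) (a : nat -> nat -> R) :
  (forall j, approx K (f j) (a j)) ->
  approx K (fun lam => \sum_(j < d) f j lam) (fun n => \sum_(j < d) a j n).
Proof.
move=> fa; elim: d => [|d IHd].
  exists 0, 0 => lam _; rewrite big_ord0 big1 ?subr0 ?mul0r.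
    by rewrite -[0]/(0%:C) normc_real normr0.
  by move=> n _; rewrite big_ord0 mul0r.
have [C [M H]] := approxD IHd (fa d); exists C, M => lam /H.
rewrite big_ord_recr /=; congr (normc (_ - _) <= _); apply: eq_bigr => n _.
by rewrite big_ord_recr.
Qed.

Lemma normc_sub_ge (lam : R[i]) : 8 * rc < normc lam ->
  normc lam / 2 <= normc (lam - (4 * rc)%:C).
Proof.
move=> hl; have : normc lam <= normc (lam - (4 * rc)%:C) + 4 * rc.
  have := normcD_le (lam - (4 * rc)%:C) (4 * rc)%:C.
  by rewrite subrK normc_real ger0_norm // mulr_ge0 // ltW.
lra.
Qed.

Variable v : R[i] -> R[i].
Hypothesis v_sqr : forall lam, 4 * rc < normc lam ->
  v lam ^+ 2 * (lam - (4 * rc)%:C) = lam.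
Hypothesis v_lim : forall e : R, 0 < e -> exists M : R, forall lam,
  M < normc lam -> normc (v lam - 1) < e.

Let coef0 n : R := 'C(2 * n, n)%:R * rc ^+ n.

(** With [w = rc / lam] and the truncated series [T] in [w], both squares nearly invert [1 - 4 w],
    so [(v - T) (v + T) (1 - 4 w)] is of order [w^(K+1)]. As [v] and [T] lie within 1/2 of 1,
    [v + T] has modulus at least 1; [1 - 4 w] has modulus at least 1/2, whence the factor 2. *)
Lemma approx_sqrt K : approx K.+1 v coef0.
Proof.
have [E TE] := central_poly_sqr R K.
pose T := central_poly R K.+1.
have [CE CE0 HE] := ev_bound E.
have [q Tq] : exists q : {poly R}, T = 1 + q * 'X.
  exists (drop_poly 1 T); rewrite -{1}[T](poly_take_drop 1) expr1; congr (_ + _).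
  apply/polyP => i; rewrite coef_take_poly coef1.
  by case: i => [|i] //=; rewrite coef_poly /= bin0.
have [Cq Cq0 Hq] := ev_bound q.
have half0 : 0 < 1 / 2 :> R by lra.
have [M0 HM0] := v_lim half0.
(* Beyond [8 rc] the modulus of [1 - 4 w] is at least 1/2; beyond [2 Cq rc], [T] is within 1/2 of
   1. *)
exists (2 * CE * rc ^+ K.+1), (Num.max M0 (8 * rc + 2 * Cq * rc)) => lam.
rewrite gt_max => /andP[hM0 hl].
have Cqr : 0 <= Cq * rc by rewrite mulr_ge0 // ltW.
have hl8 : 8 * rc < normc lam by lra.
have hl4 : 4 * rc < normc lam by have := rc0; lra.
have l0 : 0 < normc lam by have := rc0; lra.
have lam0 : lam != 0 by rewrite -normc_gt0.
pose w := rc%:C * lam^-1.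
have nw : normc w = rc / normc lam by rewrite normcM normc_real gtr0_norm // normcV.
have w1 : normc w <= 1 by rewrite nw ler_pdivrMr // mul1r; have := rc0; lra.
have ST : \sum_(n < K.+1) (coef0 n)%:C * lam^-1 ^+ n = ev w T.
  rewrite -[RHS]mul1r ev_poly; apply: eq_bigr => n _.
  by rewrite mul1r /w exprMn /coef0 rmorphM rmorphXn mulrA.
rewrite ST.
have vS : normc (v lam - 1) <= 1 / 2 by apply/ltW/HM0.
have TS : normc (ev w T - 1) <= 1 / 2.
  rewrite Tq rmorphD rmorph1 rmorphM evX addrC addKr normcM nw.
  have := Hq w w1 => Hqw.
  rewrite mulrA ler_pdivrMr //.
  have : normc (ev w q) * rc <= Cq * rc by rewrite ler_wpM2r // ltW.
  have := rc0; lra.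
have vT1 : 1 <= normc (v lam + ev w T).
  have H1 : normc (2 : R[i]) = 2 := normc_nat R 2.
  have : normc (2 : R[i]) <= normc (v lam + ev w T) + (normc (v lam - 1) + normc (ev w T - 1)).
    rewrite (_ : (2 : R[i]) = (v lam + ev w T) - ((v lam - 1) + (ev w T - 1))); last by ring.
    apply: le_trans (normcB_le _ _) _; apply: lerD => //; exact: normcD_le.
  rewrite H1; lra.
have d2 : 1 / 2 <= normc (1 - 4 * w).
  have := normc_sub_ge hl8.
  rewrite (_ : lam - (4 * rc)%:C = lam * (1 - 4 * w)); last first.
    rewrite /w rmorphM rmorph_nat mulrBr mulr1; congr (_ - _).
    by rewrite mulrCA [lam * _]mulrCA mulfV // mulr1.
  by rewrite normcM => H; rewrite -(ler_pM2l l0) mulrA mulr1.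
have eqn : (v lam - ev w T) * ((v lam + ev w T) * (1 - 4 * w)) = - (ev w E * w ^+ K.+1).
  have v1 : v lam ^+ 2 * (1 - 4 * w) = 1.
    have /(congr1 (fun z => z / lam)) := v_sqr hl4; rewrite mulfV // => lE.
    rewrite -[RHS]lE /w rmorphM rmorph_nat; field.
    by [].
  have T1 : (1 - 4 * w) * ev w T ^+ 2 = 1 + ev w E * w ^+ K.+1.
    have /(congr1 (ev w)) := TE; rewrite rmorphM rmorphB rmorph1 evZ evX rmorph_nat.
    by rewrite rmorphXn rmorphD rmorph1 rmorphM rmorphXn evX.
  transitivity (v lam ^+ 2 * (1 - 4 * w) - (1 - 4 * w) * ev w T ^+ 2); first by ring.
  by rewrite v1 T1; ring.
have := congr1 (@normc R) eqn; rewrite normcN !normcM normcX nw => neq.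
have Hw := HE w w1.
have n0 := normc_ge0 (v lam - ev w T).
have prod : 1 / 2 <= normc (v lam + ev w T) * normc (1 - 4 * w).
  by rewrite -[1 / 2]mul1r; apply: ler_pM.
have rl : 0 <= (rc / normc lam) ^+ K.+1 by rewrite exprn_ge0 // divr_ge0 // ltW.
have : normc (v lam - ev w T) * (1 / 2) <= CE * (rc / normc lam) ^+ K.+1.
  apply: le_trans (_ : _ <= normc (ev w E) * (rc / normc lam) ^+ K.+1) _.
    by rewrite -neq; apply: ler_wpM2l.
  exact: ler_wpM2r.
rewrite exprMn exprVn => H; rewrite -!mulrA; lra.
Qed.

(** The [j]-th derivative in [rc] of ['C(2n, n) rc^n]. For [n < j] the truncated exponent is
    harmless, the falling factorial being 0. *)
Definition coefs j n : R := ('C(2 * n, n) * n ^_ j)%:R * rc ^+ (n - j).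

(** Coefficientwise form of [(lam - 4 rc) F_(j+1) = 2 (2j+1) F_j], where [F_j] is the [j]-th
    derivative in [rc] of [lam^(1/2) (lam - 4 rc)^(-1/2)]: the exponent [-1/2 - j] yields the factor
    [4 (1/2 + j)]. *)
Lemma coefs_rec j n :
  coefs j.+1 n.+1 - 4 * rc * coefs j.+1 n = (2 * (2 * j).+1)%:R * coefs j n.
Proof.
rewrite /coefs subSS ffactSS ffactnSr.
have [nj|jn] := ltnP n j; first by rewrite ffact_small // !(mul0n, muln0, mul0r) mulr0 subrr mulr0.
have cb : (n.+1)%:R * 'C(2 * n.+1, n.+1)%:R = (2 * (2 * n).+1)%:R * 'C(2 * n, n)%:R :> R.
  by rewrite -!natrM central_binS.
have [njE|njN] := eqVneq (n - j)%N 0%N.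
  have -> : n = j by lia.
  rewrite subnn !muln0 mul0r mulr0 subr0 expr0 !mulr1 mulnCA mulnA mulnC.
  by rewrite central_binS -natrM; congr (_%:R); lia.
rewrite (_ : (n - j)%N = (n - j.+1).+1); last lia.
have nR : (n - j.+1).+1%:R = n%:R - j%:R :> R.
  by rewrite -natrB //; congr (_%:R); lia.
rewrite exprS !natrM.
transitivity ((n.+1)%:R * 'C(2 * n.+1, n.+1)%:R * (n ^_ j)%:R * (rc * rc ^+ (n - j.+1))
   - 4 * rc * ('C(2 * n, n)%:R * ((n ^_ j)%:R * (n%:R - j%:R)) * rc ^+ (n - j.+1))).
  by rewrite nR; ring.
by rewrite cb; ring.
Qed.

(** The extra summand is the first one beyond the truncation, which multiplication by [lam] brings
    back into range. *)
Lemma coefs_sum j K lam : lam != 0 ->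
  (lam - (4 * rc)%:C) * (\sum_(n < K.+1) (coefs j.+1 n)%:C * lam^-1 ^+ n)
  + (coefs j.+1 K.+1)%:C * lam^-1 ^+ K =
  (2 * (2 * j).+1)%:R * (\sum_(n < K.+1) (coefs j n)%:C * lam^-1 ^+ n).
Proof.
move=> lam0; have rec n : (coefs j.+1 n.+1)%:C - (4 * rc)%:C * (coefs j.+1 n)%:C
    = (2 * (2 * j).+1)%:R * (coefs j n)%:C.
  by rewrite -rmorphM -rmorphB coefs_rec rmorphM rmorph_nat.
elim: K => [|K IHK].
  rewrite !big_ord1 !expr0 !mulr1 -rec.
  by rewrite {1}/coefs ffactnS mul0n muln0 mul0r rmorph0 mulr0 add0r
    {3}/coefs ffactnS mul0n muln0 mul0r rmorph0 mulr0 subr0.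
rewrite big_ord_recr [in RHS]big_ord_recr /= !mulrDr -IHK [in RHS]mulrA -rec.
rewrite [lam^-1 ^+ K.+1]exprS; field.
by [].
Qed.

Definition dfac j : R := (2 ^ j * dfact_odd j)%:R.

Lemma dfacS j : dfac j.+1 = (2 * (2 * j).+1)%:R * dfac j.
Proof. by rewrite /dfac -natrM; congr (_%:R); rewrite expnS /dfact_odd big_ord_recr /=; lia. Qed.

(** By [coefs_sum] the error for [j + 1] is the error for [j], plus one term in [lam^-K], divided by
    [lam - 4 rc]. This divisor is at least [|lam| / 2] in modulus, which restores the order [K + 1]
    at the cost of a factor 2. *)
Lemma approx_sqrt_pow j K :
  approx K.+1 (fun lam => (dfac j)%:C * (v lam * (lam - (4 * rc)%:C)^-1 ^+ j)) (coefs j).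
Proof.
elim: j => [|j [C [M H]]].
  have [C [M H]] := approx_sqrt K; exists C, M => lam /H.
  rewrite /dfac /dfact_odd big_ord0 expr0 !mulr1 mul1r.
  congr (normc (_ - _) <= _); apply: eq_bigr => n _.
  by rewrite /coefs ffactn0 muln1 subn0.
exists (2 * ((2 * (2 * j).+1)%:R * C + `|coefs j.+1 K.+1|)), (Num.max M (8 * rc + 1)) => lam.
rewrite gt_max => /andP[hM hl].
have hl8 : 8 * rc < normc lam by lra.
have l1 : 1 < normc lam by have := rc0; lra.
have l0 : 0 < normc lam by lra.
have lam0 : lam != 0 by rewrite -normc_gt0.
have dge := normc_sub_ge hl8.
set d := lam - _ in dge *.
have nd0 : 0 < normc d by apply: lt_le_trans dge; lra.
have d0 : d != 0 by rewrite -normc_gt0.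
have := H lam hM; rewrite -/d; have := coefs_sum j K lam0; rewrite -/d.
set S1 := \sum_(n < _) _; set S0 := \sum_(n < _) _.
set F := _ * (_ * _) => HS HF.
rewrite dfacS rmorphM rmorph_nat exprS.
rewrite (_ : _ - _ = d^-1 * ((2 * (2 * j).+1)%:R * (F - S0)
   + (coefs j.+1 K.+1)%:C * lam^-1 ^+ K)); last first.
  rewrite [_ * (F - S0)]mulrBr -HS /F; field.
  by [].
rewrite normcM normcV.
set A := _%:R * C + _; set N := normc (_ * (F - S0) + _).
have lK : C * (normc lam)^-1 ^+ K = C * (normc lam)^-1 ^+ K.+1 * normc lam.
  by rewrite exprSr -!mulrA mulVf ?mulr1 // gt_eqF.
have nb : N <= A * (normc lam)^-1 ^+ K.
  apply: le_trans (normcD_le _ _) _; rewrite /A mulrDl; apply: lerD.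
    rewrite normcM normc_nat -mulrA ler_wpM2l // lK.
    apply: (le_trans HF); rewrite ler_peMr ?(le_trans (normc_ge0 _) HF) //.
    exact: ltW.
  by rewrite normcM normc_real normcX normcV.
have N0 : 0 <= N by apply: normc_ge0.
rewrite ler_pdivrMl //.
have AK : A * (normc lam)^-1 ^+ K = normc lam / 2 * (2 * A * (normc lam)^-1 ^+ K.+1).
  rewrite exprS; field.
  by rewrite gt_eqF.
apply: (le_trans nb); rewrite AK; apply: ler_wpM2r => //.
rewrite (_ : 2 * A * _ = A * (normc lam)^-1 ^+ K * (2 / normc lam)); last by rewrite exprS; ring.
by apply: mulr_ge0; [exact: (le_trans N0 nb)|rewrite divr_ge0 // ltW].
Qed.

End Asymptotics.

(** * Means of continuous complex functions over a circle *)

Section CircleMean.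
Variable R : realType.
Implicit Types (f g w : R -> R[i]) (c z : R[i]) (t a b : R).

Lemma ReD (x y : R[i]) : complex.Re (x + y) = complex.Re x + complex.Re y.
Proof. by case: x => ? ?; case: y. Qed.

Lemma ImD (x y : R[i]) : complex.Im (x + y) = complex.Im x + complex.Im y.
Proof. by case: x => ? ?; case: y. Qed.

Lemma ReM (x y : R[i]) :
  complex.Re (x * y) = complex.Re x * complex.Re y - complex.Im x * complex.Im y.
Proof. by case: x => ? ?; case: y. Qed.

Lemma ImM (x y : R[i]) :
  complex.Im (x * y) = complex.Re x * complex.Im y + complex.Im x * complex.Re y.
Proof. by case: x => ? ?; case: y. Qed.

Definition ccont f : Prop :=
  continuous (fun t => complex.Re (f t) : R) /\ continuous (fun t => complex.Im (f t) : R).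

Lemma ccontD f g : ccont f -> ccont g -> ccont (fun t => f t + g t).
Proof.
move=> [f1 f2] [g1 g2]; split => t.
  under eq_fun do rewrite ReD.
  by apply: cvgD; [apply: f1|apply: g1].
under eq_fun do rewrite ImD.
by apply: cvgD; [apply: f2|apply: g2].
Qed.

Lemma ccontM f g : ccont f -> ccont g -> ccont (fun t => f t * g t).
Proof.
move=> [f1 f2] [g1 g2]; split => t.
  under eq_fun do rewrite ReM.
  by apply: cvgB; apply: cvgM; [apply: f1|apply: g1|apply: f2|apply: g2].
under eq_fun do rewrite ImM.
by apply: cvgD; apply: cvgM; [apply: f1|apply: g2|apply: f2|apply: g1].
Qed.

Lemma ccont_cst c : ccont (fun=> c).
Proof. by split; apply: cst_continuous. Qed.

Lemma ccontX f n : ccont f -> ccont (fun t => f t ^+ n).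
Proof.
move=> cf; elim: n => [|n IHn]; first by under eq_fun do rewrite expr0; apply: ccont_cst.
by under eq_fun do rewrite exprS; apply: ccontM.
Qed.

Lemma ccont_sum n (F : 'I_n -> R -> R[i]) :
  (forall i, ccont (F i)) -> ccont (fun t => \sum_(i < n) F i t).
Proof.
move=> cF; elim: n F cF => [|n IHn] F cF.
  by under eq_fun do rewrite big_ord0; apply: ccont_cst.
under eq_fun do rewrite big_ord_recr /=.
by apply: ccontD => //; apply: IHn.
Qed.

Lemma ccontV f : (forall t, f t != 0) -> ccont f -> ccont (fun t => (f t)^-1).
Proof.
move=> f0 [f1 f2].
pose n t := complex.Re (f t) ^+ 2 + complex.Im (f t) ^+ 2.
have n0 t : n t != 0.
  rewrite /n paddr_eq0 ?sqr_ge0 // !sqrf_eq0; apply: contra (f0 t).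
  by rewrite eq_complex.
have nc : continuous (fun t => (n t)^-1 : R).
  move=> t; apply: cvgV; first exact: n0.
  by apply: cvgD; rewrite expr2; apply: cvgM; (apply: f1 || apply: f2).
split=> t.
  rewrite (_ : (fun _ => _) = (fun t => complex.Re (f t) * (n t)^-1)); last first.
    by apply/funext => s; rewrite /n; case: (f s).
  by apply: cvgM; [apply: f1|apply: nc].
rewrite (_ : (fun _ => _) = (fun t => - complex.Im (f t) * (n t)^-1)); last first.
  by apply/funext => s; rewrite /n; case: (f s) => u v /=; rewrite mulNr.
by apply: cvgM; [apply: cvgN; apply: f2|apply: nc].
Qed.

(** For [h = w^2] the positive real part is [sqrt ((|h| + Re h) / 2)], and the imaginary part is
    [Im h] divided by twice the real part. *)
Lemma ccont_sqrt w : (forall t, 0 < complex.Re (w t)) ->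
  ccont (fun t => w t ^+ 2) -> ccont w.
Proof.
move=> w0 [c1 c2].
pose h t := w t ^+ 2.
pose n t := complex.Re (h t) ^+ 2 + complex.Im (h t) ^+ 2.
have hE t : complex.Re (h t) = complex.Re (w t) ^+ 2 - complex.Im (w t) ^+ 2.
  by rewrite /h expr2 ReM !expr2.
have hI t : complex.Im (h t) = 2 * complex.Re (w t) * complex.Im (w t).
  by rewrite /h expr2 ImM; ring.
have nE t : Num.sqrt (n t) = complex.Re (w t) ^+ 2 + complex.Im (w t) ^+ 2.
  rewrite /n hE hI.
  transitivity (Num.sqrt ((complex.Re (w t) ^+ 2 + complex.Im (w t) ^+ 2) ^+ 2)).
    by congr Num.sqrt; ring.
  by rewrite sqrtr_sqr ger0_norm // addr_ge0 ?sqr_ge0.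
have wRe : (fun t => complex.Re (w t)) =
    (fun t => Num.sqrt ((Num.sqrt (n t) + complex.Re (h t)) / 2)).
  apply/funext => t; rewrite nE hE.
  rewrite (_ : _ / 2 = complex.Re (w t) ^+ 2); last by field.
  by rewrite sqrtr_sqr gtr0_norm.
have cRe : continuous (fun t => complex.Re (w t) : R).
  rewrite wRe => t; apply: continuous_comp; last exact: sqrt_continuous.
  apply: cvgM; last exact: cvg_cst.
  apply: cvgD; last exact: c1.
  apply: continuous_comp; last exact: sqrt_continuous.
  by apply: cvgD; rewrite expr2; apply: cvgM; (apply: c1 || apply: c2).
split=> // t.
rewrite (_ : (fun _ => _) = (fun t => complex.Im (h t) * (2 * complex.Re (w t))^-1)); last first.
  apply/funext => s; rewrite hI mulrAC mulfV ?mul1r //.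
  by rewrite gt_eqF // mulr_gt0.
apply: cvgM; first exact: c2.
apply: cvgV; first by rewrite mulf_neq0 ?gt_eqF.
by apply: cvgM; [exact: cvg_cst|exact: cRe].
Qed.

Definition cmean f : R[i] := ((2 * pi)^-1)%:C *
  ((Rintegral lebesgue_measure `[0, 2 * pi] (fun t => complex.Re (f t)))
   +i* (Rintegral lebesgue_measure `[0, 2 * pi] (fun t => complex.Im (f t)))).

Lemma contour_intE (f : R[i] -> R[i]) rho :
  contour_int f rho = cmean (fun t => f (circle_pt rho t) * circle_pt rho t).
Proof. by []. Qed.

Lemma continuous_integrable (f : R -> R) a b : continuous f ->
  lebesgue_measure.-integrable `[a, b] (EFin \o f).
Proof.
move=> cf; apply: continuous_compact_integrable; first exact: segment_compact.
exact: continuous_subspaceT.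
Qed.

Lemma cmeanD f g : ccont f -> ccont g ->
  cmean (fun t => f t + g t) = cmean f + cmean g.
Proof.
move=> [f1 f2] [g1 g2]; rewrite /cmean -mulrDr; congr (_ * _).
under eq_Rintegral do rewrite ReD.
under [X in _ +i* X]eq_Rintegral do rewrite ImD.
by rewrite !RintegralD //; apply: continuous_integrable.
Qed.

Lemma cmeanZ c f : ccont f -> cmean (fun t => c * f t) = c * cmean f.
Proof.
move=> [f1 f2]; rewrite /cmean mulrCA; congr (_ * _).
under eq_Rintegral do rewrite ReM.
under [X in _ +i* X]eq_Rintegral do rewrite ImM.
case: c => u v /=.
have cZ (k : R) (h : R -> R) : continuous h -> continuous (fun t => k * h t).
  by move=> ch t; apply: cvgM; [exact: cvg_cst|exact: ch].
rewrite RintegralB //; try by apply: continuous_integrable; apply: cZ.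
rewrite RintegralD //; try by apply: continuous_integrable; apply: cZ.
by rewrite !RintegralZl //; apply: continuous_integrable.
Qed.

Lemma cmean_sum n (F : 'I_n -> R -> R[i]) : (forall i, ccont (F i)) ->
  cmean (fun t => \sum_(i < n) F i t) = \sum_(i < n) cmean (F i).
Proof.
move=> cF; elim: n F cF => [|n IHn] F cF.
  rewrite big_ord0 (_ : (fun _ => _) = (fun t => 0 * (fun=> 0) t)).
    by rewrite cmeanZ ?mul0r //; apply: ccont_cst.
  by apply/funext => t; rewrite big_ord0 mul0r.
rewrite big_ord_recr /= -IHn // -cmeanD //; last exact: ccont_sum.
by congr cmean; apply/funext => t; rewrite big_ord_recr.
Qed.

Lemma two_pi_gt0 : 0 < 2 * pi :> R.
Proof. by rewrite mulr_gt0 ?pi_gt0. Qed.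

Lemma Rintegral_cst2pi (k : R) :
  Rintegral lebesgue_measure `[0, 2 * pi] (fun=> k) = k * (2 * pi).
Proof.
rewrite Rintegral_cst //; congr (_ * _).
rewrite (_ : fine _ = fine (2 * pi)%:E) //; congr fine.
apply: etrans (lebesgue_measure_itv `[0, 2 * pi]%R) _.
by rewrite /= lte_fin two_pi_gt0 sube0.
Qed.

(** The factor 2 comes from bounding the real and imaginary integrals separately; the limit in the
    radius absorbs it. *)
Lemma cmean_le f C : ccont f -> (forall t, normc (f t) <= C) ->
  normc (cmean f) <= 2 * C.
Proof.
have pi0 := two_pi_gt0; have pi0' : 0 <= (2 * pi)^-1 :> R by rewrite invr_ge0 ltW.
move=> [f1 f2] fC; rewrite /cmean normcM normc_real ger0_norm //.
have ReC t : `|complex.Re (f t)| <= C.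
  by apply: le_trans (fC t); rewrite /normc -sqrtr_sqr ler_wsqrtr // lerDl sqr_ge0.
have ImC t : `|complex.Im (f t)| <= C.
  by apply: le_trans (fC t); rewrite /normc -sqrtr_sqr ler_wsqrtr // lerDr sqr_ge0.
have bound (h : R -> R) : continuous h -> (forall t, `|h t| <= C) ->
    `|Rintegral lebesgue_measure `[0, 2 * pi] h| <= C * (2 * pi).
  move=> ch hC; rewrite -Rintegral_cst2pi.
  apply: le_trans (le_normr_Rintegral _ _) _ => //; first exact: continuous_integrable.
  apply: le_Rintegral => //.
  - by apply: continuous_integrable => t; apply: continuous_comp; [apply: ch|apply: norm_continuous].
  - by apply: continuous_integrable; apply: cst_continuous.
rewrite ler_pdivrMl //.
set x := Rintegral _ _ _; set y := Rintegral _ _ _.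
apply: le_trans (_ : _ <= `|x| + `|y|) _.
  have -> : (x +i* y)%C = x%:C + 'i%C * y%:C by apply/eqP; rewrite eq_complex /=; apply/andP; split; apply/eqP; ring.
  apply: le_trans (normcD_le _ _) _; rewrite normcM !normc_real.
  by rewrite (_ : normc 'i%C = 1) ?mul1r // /normc /= expr0n add0r expr1n sqrtr1.
have := bound _ f1 ReC; have := bound _ f2 ImC; rewrite -/x -/y; lra.
Qed.

Definition cexp a : R[i] := (cos a +i* sin a)%C.

Lemma cexp0 : cexp 0 = 1.
Proof. by rewrite /cexp cos0 sin0. Qed.

Lemma cexpD a b : cexp (a + b) = cexp a * cexp b.
Proof. by rewrite /cexp cosD sinD; apply/eqP; rewrite eq_complex /=; apply/andP; split; apply/eqP; ring. Qed.

Lemma cexpN a : cexp (- a) = (cexp a)^-1.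
Proof.
have H : cexp a * cexp (- a) = 1 by rewrite -cexpD subrr cexp0.
have a0 : cexp a != 0 by apply: contra_eq_neq H => ->; rewrite mul0r eq_sym oner_neq0.
by apply: (mulfI a0); rewrite H mulfV.
Qed.

Lemma cexpMn a n : cexp a ^+ n = cexp (n%:R * a).
Proof.
elim: n => [|n IHn]; first by rewrite expr0 mul0r cexp0.
by rewrite exprS IHn -cexpD; congr cexp; rewrite -[in RHS]addn1 natrD; ring.
Qed.

Lemma normc_cexp a : normc (cexp a) = 1.
Proof. by rewrite /normc /= cos2Dsin2 sqrtr1. Qed.

Lemma circle_ptE rho t : circle_pt rho t = rho%:C * cexp t.
Proof. by apply/eqP; rewrite eq_complex /=; apply/andP; split; apply/eqP; ring. Qed.

Lemma normc_circle_pt rho t : 0 < rho -> normc (circle_pt rho t) = rho.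
Proof. by move=> r0; rewrite circle_ptE normcM normc_cexp mulr1 normc_real gtr0_norm. Qed.

Lemma circle_pt_pow rho t k n :
  circle_pt rho t ^+ k * (circle_pt rho t)^-1 ^+ n =
  (rho ^+ k * rho^-1 ^+ n)%:C * cexp ((k%:R - n%:R) * t).
Proof.
rewrite circle_ptE invfM -cexpN !exprMn !cexpMn mulrBl cexpD -mulrN.
by rewrite rmorphM !rmorphXn fmorphV; ring.
Qed.

Lemma continuous_lin q : continuous (fun t : R => q * t).
Proof. by move=> t; apply: cvgM; [exact: cvg_cst|exact: cvg_id]. Qed.

Lemma ccont_cexp q : ccont (fun t => cexp (q * t)).
Proof.
split=> t /=; apply: (@continuous_comp _ _ _ (fun t : R => q * t)).
- exact: continuous_lin.
- exact: continuous_cos.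
- exact: continuous_lin.
- exact: continuous_sin.
Qed.

Lemma ccont_circle_pt rho : ccont (circle_pt rho).
Proof.
have := ccontM (ccont_cst rho%:C) (ccont_cexp 1).
by congr ccont; apply/funext => t; rewrite mul1r circle_ptE.
Qed.

Lemma Rintegral_FTC (F f : R -> R) a b : a < b -> continuous f ->
  (forall t, is_derive t 1 F (f t)) ->
  Rintegral lebesgue_measure `[a, b] f = F b - F a.
Proof.
move=> ab cf dF; rewrite /Rintegral.
have cF : continuous F.
  by move=> t; apply: differentiable_continuous; apply/derivable1_diffP; apply: ex_derive.
rewrite (@continuous_FTC2 _ f F a b) //.
- exact: continuous_subspaceT.
- split.
  + by move=> t _; apply: ex_derive.
  + by apply: cvg_at_right_filter; apply: cF.
  + by apply: cvg_at_left_filter; apply: cF.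
- by move=> t _; rewrite derive1E; apply: derive_val.
Qed.

Lemma cos_sin_2pin n : cos (n%:R * (2 * pi)) = 1 :> R /\ sin (n%:R * (2 * pi)) = 0 :> R.
Proof.
have -> : n%:R * (2 * pi) = 0 + pi *+ 2 *+ n :> R.
  by rewrite add0r -[RHS]mulr_natl -[pi *+ 2]mulr_natl.
by rewrite (periodicn (@cosD2pi R)) (periodicn (@sinD2pi R)) cos0 sin0.
Qed.

Lemma cmean_cexp k n : cmean (fun t => cexp ((k%:R - n%:R) * t)) = (k == n)%:R.
Proof.
have [->|kn] := eqVneq k n.
  rewrite /cmean subrr /=.
  under eq_Rintegral do rewrite mul0r cos0.
  under [X in _ +i* X]eq_Rintegral do rewrite mul0r sin0.
  rewrite !Rintegral_cst2pi mul0r mul1r complexr0 -rmorphM mulVf ?gt_eqF ?two_pi_gt0 //.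
have q0 : k%:R - n%:R != 0 :> R by rewrite subr_eq0 eqr_nat.
move: (q0); set q := _ - _ => {}q0.
have [c2 s2] : cos (q * (2 * pi)) = 1 /\ sin (q * (2 * pi)) = 0.
  have [ck sk] := cos_sin_2pin k; have [cn sn] := cos_sin_2pin n.
  by rewrite /q mulrBl cosB sinB ck sk cn sn; split; ring.
have dl t : is_derive t 1 (fun t : R => q * t) q.
  by apply: is_derive_eq; rewrite /GRing.scale /= mulr1.
have [cc cs] := ccont_cexp q.
have ic : Rintegral lebesgue_measure `[0, 2 * pi] (fun t => cos (q * t)) = 0.
  have dF t : is_derive t 1 (fun t => q^-1 * sin (q * t)) (cos (q * t)).
    have H := is_derive1_comp (is_derive_sin (q * t)) (dl t).
    by apply: (is_derive_eq (is_deriveZ q^-1 H)); rewrite /GRing.scale /=; field.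
  by rewrite (Rintegral_FTC two_pi_gt0 cc dF) mulr0 s2 sin0 mulr0 subrr.
have is_ : Rintegral lebesgue_measure `[0, 2 * pi] (fun t => sin (q * t)) = 0.
  have dF t : is_derive t 1 (fun t => - q^-1 * cos (q * t)) (sin (q * t)).
    have H := is_derive1_comp (is_derive_cos (q * t)) (dl t).
    by apply: (is_derive_eq (is_deriveZ (- q^-1) H)); rewrite /GRing.scale /=; field.
  by rewrite (Rintegral_FTC two_pi_gt0 cs dF) mulr0 c2 cos0 subrr.
by rewrite /cmean /= ic is_ complexr0 rmorph0 mulr0.
Qed.

End CircleMean.

(** * The contour integral against [V_lam] and the derivatives of [W] *)

Section ContourValue.
Variables (R : realType) (p : nat) (g : nat -> R).

Lemma Vlam_mul lam :
  Vlam p g lam * lam = \sum_(i < p) (g i.+1 * i.+1%:R)%:C * lam ^+ i.+1.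
Proof.
rewrite (_ : Vlam p g lam = ev lam (deriv (Vpoly p g))) // /Vpoly big_add1 big_mkord.
have -> : deriv (\sum_(i < p) g i.+1 *: 'X^(i.+1)) =
    \sum_(i < p) (g i.+1 * i.+1%:R) *: 'X^i.
  rewrite (raddf_sum deriv); apply: eq_bigr => i _.
  by rewrite /= derivZ derivXn -scaler_nat scalerA.
rewrite rmorph_sum mulr_suml; apply: eq_bigr => i _.
by rewrite evZ rmorphXn evX -mulrA -exprSr.
Qed.

(** [V_lam] times the factor [lam] of the parametrization has degree [p], so dropping terms of order
    [lam^-(p+1)] in [h] changes the integral by [O(1 / rho)]. The integral does not depend on [rho],
    hence equals the mean of the truncated product, where only [lam^0] survives. *)
Lemma contour_value (h : R[i] -> R[i]) (A : nat -> R) (M : R) (c : R[i]) :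
  approx p.+1 h A ->
  (forall rho, M < rho -> ccont (fun t => h (circle_pt rho t))) ->
  (forall rho, M < rho -> contour_int (fun lam => Vlam p g lam * h lam) rho = c) ->
  c = (\sum_(i < p) g i.+1 * i.+1%:R * A i.+1)%:C.
Proof.
move=> [C [M1 hA]] ch hc; set L := _%:C.
pose G i : R := g i.+1 * i.+1%:R.
pose CQ := \sum_(i < p) `|G i|.
have CQ0 : 0 <= CQ by apply: sumr_ge0.
have key rho : 1 < rho -> M < rho -> M1 < rho -> normc (c - L) <= 2 * (CQ * C) / rho.
  move=> r1 rM rM1; have r0 : 0 < rho by apply: lt_trans r1.
  have rhoN : rho != 0 by rewrite gt_eqF.
  pose z := circle_pt rho; have zn t : normc (z t) = rho by apply: normc_circle_pt.
  have zc : ccont z by apply: ccont_circle_pt.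
  have z0 t : z t != 0 by rewrite -normc_gt0 zn.
  pose S t := \sum_(n < p.+1) (A n)%:C * (z t)^-1 ^+ n.
  pose Q t := \sum_(i < p) (G i)%:C * z t ^+ i.+1.
  have cS : ccont S.
    apply: ccont_sum => n; apply: ccontM; first exact: ccont_cst.
    by apply: ccontX; apply: ccontV.
  have cQ : ccont Q.
    by apply: ccont_sum => n; apply: ccontM; [exact: ccont_cst|exact: ccontX].
  have meanL : cmean (fun t => Q t * S t) = L.
    pose F (i : 'I_p) t := \sum_(n < p.+1)
      ((G i * A n) * (rho ^+ i.+1 * rho^-1 ^+ n))%:C * cexp ((i.+1%:R - n%:R) * t).
    rewrite (_ : (fun t => _) = (fun t => \sum_(i < p) F i t)); last first.
      apply/funext => t; rewrite /Q mulr_suml; apply: eq_bigr => i _.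
      rewrite /S mulr_sumr; apply: eq_bigr => n _.
      rewrite [(_ * _ * _)%:C]rmorphM -[RHS]mulrA -circle_pt_pow.
      by rewrite (rmorphM _ (G i) (A n)) -/(z t) /=; ring.
    have cF i : ccont (F i).
      by apply: ccont_sum => n; apply: ccontM; [exact: ccont_cst|exact: ccont_cexp].
    rewrite cmean_sum // /L rmorph_sum; apply: eq_bigr => i _.
    rewrite /F cmean_sum => [|n]; last first.
      by apply: ccontM; [exact: ccont_cst|exact: ccont_cexp].
    have iS : (i.+1 < p.+1)%N by rewrite ltnS.
    rewrite (bigD1 (Ordinal iS)) //= big1 ?addr0 => [|n ni]; last first.
      rewrite cmeanZ; last exact: ccont_cexp.
      rewrite cmean_cexp (_ : (_ == _) = false) ?mulr0 //.
      by apply/negbTE; apply: contra ni => /eqP ni; apply/eqP/val_inj.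
    rewrite cmeanZ; last exact: ccont_cexp.
    by rewrite cmean_cexp eqxx mulr1 -exprMn mulfV // expr1n mulr1.
  have meanh : cmean (fun t => Q t * h (z t)) = c.
    rewrite -(hc rho rM) contour_intE; congr cmean; apply/funext => t.
    by rewrite /Q -(Vlam_mul (z t)); rewrite -/(z t); ring.
  have -> : c - L = cmean (fun t => Q t * (h (z t) - S t)).
    rewrite -meanh -meanL -[X in _ - X]mul1r -mulNr -cmeanZ; last exact: ccontM.
    rewrite -cmeanD; first by congr cmean; apply/funext => t; ring.
      by apply: ccontM => //; apply: ch.
    by apply: ccontM; [exact: ccont_cst|exact: ccontM].
  rewrite -mulrA; apply: cmean_le.
    apply: ccontM => //; apply: ccontD; first exact: ch.
    rewrite (_ : (fun t => _) = (fun t => (-1) * S t)).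
      by apply: ccontM => //; apply: ccont_cst.
    by apply/funext => t; rewrite mulN1r.
  move=> t; rewrite normcM.
  have Qb : normc (Q t) <= CQ * rho ^+ p.
    apply: le_trans (normc_sum_le _) _; rewrite /CQ mulr_suml; apply: ler_sum => i _.
    rewrite normcM normc_real normcX zn ler_wpM2l // ler_weXn2l //; exact: ltW.
  have Hb := hA (z t); rewrite zn in Hb; have {}Hb := Hb rM1.
  rewrite -mulrA mulrA.
  rewrite (_ : CQ * C / rho = CQ * rho ^+ p * (C * rho^-1 ^+ p.+1)).
    by apply: ler_pM => //; apply: normc_ge0.
  rewrite [RHS]mulrACA; congr (_ * _).
  by rewrite exprS mulrCA -exprMn mulfV // expr1n mulr1.
apply/eqP; rewrite -subr_eq0; apply/eqP/normc0_eq0/eqP.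
rewrite -[_ == 0]negbK; apply/negP => cL0.
have d0 : 0 < normc (c - L) by rewrite lt_def cL0 normc_ge0.
set d := normc _ in d0 key.
(* A radius past all thresholds for which the bound in [key] falls below [d]. *)
pose rho := 1 + `|M| + `|M1| + `|2 * (CQ * C)| / d.
have q0 : 0 <= `|2 * (CQ * C)| / d by rewrite divr_ge0 // ltW.
have M0 := ler_norm M; have M10 := ler_norm M1.
have [m0 m1] : 0 <= `|M| /\ 0 <= `|M1| by [].
have [rM rM1] : M < rho /\ M1 < rho by split; rewrite /rho; lra.
have r1 : 1 < rho + 1 by rewrite /rho; lra.
have := key (rho + 1) r1 (lt_trans rM _) (lt_trans rM1 _).
rewrite ltrDl ltr01 => /(_ isT isT).
have r0 : 0 < rho + 1 by lra.
rewrite ler_pdivlMr // => H.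
have : `|2 * (CQ * C)| < d * (rho + 1).
  rewrite -ltr_pdivrMl // mulrC /rho; lra.
have := ler_norm (2 * (CQ * C)); lra.
Qed.

Lemma Wpoly_derivn rc j :
  (Wpoly p g)^`(j).[rc] = \sum_(i < p) g i.+1 * i.+1%:R * coefs rc j i.+1.
Proof.
rewrite /Wpoly big_add1 big_mkord raddf_sum horner_sum; apply: eq_bigr => i _.
rewrite /= derivnZ derivnXn hornerZ hornerMn hornerXn /coefs.
rewrite -mulr_natl !natrM; ring.
Qed.

End ContourValue.

(** * The Painlevé I equation for [u] *)

Theorem theorem2 (R : realType) (p : nat) (g : nat -> R) (m : nat) (rc : R)
    (I : set R) (rk : nat -> R -> R) (U : nat -> R[i] -> R -> R[i]) :
  (1 <= p)%N -> 0 < g p ->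
  (2 <= m)%N -> 0 < rc ->
  (forall k, (1 <= k < m)%N -> (Wpoly p g)^`(k).[rc] = 0) ->
  (Wpoly p g)^`(m).[rc] != 0 ->
  open I -> is_interval I ->
  (forall k, (1 <= k)%N -> smooth_on I (rk k)) ->
  (forall k x, I x -> analytic_on [set lam | 4 * rc < normc lam] (fun lam => U k lam x)) ->
  (forall k lam, 4 * rc < normc lam -> csmooth_on I (fun x => U k lam x)) ->
  (forall x lam, I x -> 4 * rc < normc lam ->
     U 0%N lam x ^+ 2 * (lam - (4 * rc)%:C) = lam) ->
  (forall x, I x -> forall e : R, 0 < e -> exists M : R, forall lam,
     M < normc lam -> normc (U 0%N lam x - 1) < e) ->
  (forall x lam N, I x -> 4 * rc < normc lam ->
     sprod (rser rc rk x)
       (sprod (fun n => User U lam x n + Ushift U lam x (-1) n)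
              (fun n => User U lam x n + Ushift U lam x 1 n)) N
     = lam * (sprod (User U lam x) (User U lam x) N - (N == 0%N)%:R)) ->
  (forall x rho N, I x -> 4 * rc < rho ->
     contour_int (fun lam => Vlam p g lam * User U lam x N) rho
     = (if N == 0%N then (Wpoly p g).[rc] else if N == (2 * m)%N then x else 0)%:C) ->
  forall Rs : nat -> dpoly R (nGD m), @GD_family R m rc Rs ->
  forall x, I x -> c_coef p g m rc * deval (Rs m) (rk 1%N) x = x.
Proof.
move=> _ _ m2 rc0 W0 _ oI iI rkS _ US Usqr Ulim Ueq Uint Rs RsP x Ix.
(* The reference point of the expansion is the given [x], so the constant branch is [U 0 lam x]. *)
have [b [_ bU b0 bm]] := @expandsP R rc I rk U m Rs x rc0 oI iI Ix rkS
  (US 0%N) Usqr Ueq RsP m.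
pose v lam := U 0%N lam x; pose d lam := lam - (4 * rc)%:C.
have vsqr lam : 4 * rc < normc lam -> v lam ^+ 2 * d lam = lam by apply: Usqr.
(* Normalised so that the accompanying function has the coefficients [coefs rc j]. *)
pose B j := b j x / dfac R j.
have dfac0 j : dfac R j != 0.
  rewrite pnatr_eq0 muln_eq0 negb_or expn_eq0 /= /dfact_odd -lt0n.
  by apply: prodn_gt0.
pose h lam := \sum_(j < m.+1) (B j)%:C * ((dfac R j)%:C * (v lam * (d lam)^-1 ^+ j)).
have hU lam : 4 * rc < normc lam -> U m lam x = h lam.
  move=> hl; rewrite bU // ev_poly; apply: eq_bigr => j _.
  by rewrite [RHS]mulrA -rmorphM divfK.
have happ : approx p.+1 h (fun n => \sum_(j < m.+1) B j * coefs rc j n).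
  apply: (@approx_sum _ p.+1 m.+1
    (fun j lam => (B j)%:C * ((dfac R j)%:C * (v lam * (d lam)^-1 ^+ j)))
    (fun j n => B j * coefs rc j n)) => j.
  apply: (@approxZ _ _ (fun lam => (dfac R j)%:C * (v lam * (d lam)^-1 ^+ j))).
  by apply: (approx_sqrt_pow rc0 vsqr (Ulim x Ix)).
have half0 : 0 < 1 / 2 :> R by lra.
have [M HM] := Ulim x Ix _ half0.
(* Beyond [M], [v] is within 1/2 of 1, so its real part is positive and [ccont_sqrt] applies. *)
pose M' := Num.max M (4 * rc).
have cont rho : M' < rho -> ccont (fun t => h (circle_pt rho t)).
  rewrite /M' gt_max => /andP[rM r4].
  have r0 : 0 < rho by have := rc0; lra.
  have nz t : normc (circle_pt rho t) = rho by apply: normc_circle_pt.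
  have cd : ccont (fun t => (d (circle_pt rho t))^-1).
    apply: ccontV; last by apply: ccontD; [exact: ccont_circle_pt|exact: ccont_cst].
    by move=> t; apply: (lam_sub_neq0 rc0 Ix Usqr); rewrite nz.
  have cv : ccont (fun t => v (circle_pt rho t)).
    apply: ccont_sqrt => [t|].
      have := HM (circle_pt rho t); rewrite nz => /(_ rM).
      rewrite -/(v _) /normc ReD /= => Hv.
      have : `|complex.Re (v (circle_pt rho t)) - 1| < 1 / 2.
        by apply: le_lt_trans Hv; rewrite -sqrtr_sqr ler_wsqrtr // lerDl sqr_ge0.
      by rewrite ltr_norml => /andP[+ _]; lra.
    rewrite (_ : (fun t => _) = (fun t => circle_pt rho t * (d (circle_pt rho t))^-1)).
      by apply: ccontM => //; apply: ccont_circle_pt.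
    apply/funext => t; have d0 : d (circle_pt rho t) != 0.
      by apply: (lam_sub_neq0 rc0 Ix Usqr); rewrite nz.
    by rewrite -{2}(vsqr (circle_pt rho t)) ?nz // mulfK.
  apply: ccont_sum => j; apply: ccontM; first exact: ccont_cst.
  apply: ccontM; first exact: ccont_cst.
  by apply: ccontM => //; apply: ccontX.
have int rho : M' < rho -> contour_int (fun lam => Vlam p g lam * h lam) rho = x%:C.
  rewrite /M' gt_max => /andP[rM r4].
  have r0 : 0 < rho by have := rc0; lra.
  have := Uint x rho (2 * m)%N Ix r4; rewrite muln_eq0 /= eqxx.
  rewrite (_ : (m == 0%N) = false) => [<-|]; last by lia.
  rewrite !contour_intE; congr cmean; apply/funext => t.
  by rewrite /User mul2n odd_double doubleK hU // normc_circle_pt.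
have := contour_value happ cont int => /complexI xE.
rewrite [RHS]xE -bm // /c_coef.
under [RHS]eq_bigr do rewrite mulr_sumr.
(* The integral is the sum of [B j] times the [j]-th derivative of [W] at [rc]: [j = 0] drops out
   because [b 0] vanishes for [m > 0], and [0 < j < m] by criticality of [rc]. *)
rewrite exchange_big /= big_ord_recr /= [X in _ = X + _]big1 ?add0r => [|j _]; last first.
  under eq_bigr do rewrite mulrCA.
  rewrite -mulr_sumr -Wpoly_derivn /B.
  have [j0|j0] := posnP j; first by rewrite j0 b0 // (_ : (m == 0%N) = false) ?mul0r //; lia.
  by rewrite W0 ?mulr0 // j0 ltn_ord.
under [RHS]eq_bigr do rewrite mulrCA.
by rewrite -mulr_sumr -Wpoly_derivn /B /dfac; ring.
Qed.
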